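(* For all integers $n \geq 2$, $\mathrm{ar}^{\star}(n, K_4^-) = \lfloor 3(n-1)/2 \rfloor$. Moreover, every star-colouring of $K_n$ that contains no rainbow copy of $K_4^-$ and uses exactly $\lfloor 3(n-1)/2\rfloor$ colours has, up to renaming the colours, the following structure. There is an ordering $v_1,\ldots,v_n$ of the vertices of $K_n$ such that the colouring is obtained by first colouring each edge $v_iv_j$ with colour $\min\{i,j\}$, and then recolouring the edges of the following graph $J$ so that all edges of each component of $J$ receive a common new colour, distinct components (with at least one edge) receiving distinct new colours: \begin{itemize} \item if $n=2m+1$ is odd, then $E(J) = \{ v_1v_2, v_3v_4,\ldots,v_{2m-1}v_{2m}\}$; \item if $n=2m\ge 4$ is even, then for some integer $a$ with $3 \leq 2a+1 \leq n-1$, $$E(J) = \{v_1v_2,v_3v_4,\ldots,v_{2a-3}v_{2a-2} \} \cup E(S) \cup \{v_{2a+2}v_{2a+3},\ldots,v_{2m-2}v_{2m-1}\},$$ where $S$ is a graph on vertex set $\{v_{2a-1},v_{2a},v_{2a+1}\}$ with one or two edges; \item if $n=2$, then $E(J)=\emptyset$. \end{itemize}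
   Context: $K_4^-$ is the graph obtained from $K_4$ by removing one edge. A star-colouring of a graph $G$ is an edge-colouring of $G$ in which every colour class is a star (a copy of $K_{1,m}$ with $m\ge 1$, a single edge being allowed). An edge-coloured graph is rainbow if all its edges have different colours. For a graph $H$, $\mathrm{ar}^{\star}(n,H)$ denotes the maximum $s\in\mathbb N$ such that there exists a star-colouring of $K_n$ using exactly $s$ colours and without a rainbow copy of $H$. In the even case, the first listed set of edges is empty if $a=1$, and the last listed set is empty if $2a+1=n-1$. *)

(* Defs.v *)
From mathcomp Require Import all_boot.

Set Implicit Arguments.
Unset Strict Implicit.
Unset Printing Implicit Defensive.

Definition pairs (T : finType) (A : {set T}) : {set {set T}} :=
  [set e : {set T} | (e \subset A) && (#|e| == 2)].

Record sgraph := SGraph {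
  vertex :> finType;
  edges : {set {set vertex}};
  edges_card2 : edges \subset pairs [set: vertex]
}.

Definition complete_graph (n : nat) : sgraph :=
  @SGraph 'I_n (pairs [set: 'I_n]) (subxx _).

Definition K4minus : sgraph :=
  @SGraph 'I_4 (pairs [set: 'I_4] :\ [set ord0; ord_max]) (subsetDl _ _).

(* An edge-colouring of G is a function c : {set G} -> C; only its values on
   [edges G] are ever used. *)

Definition colour_class (G : sgraph) (C : eqType) (c : {set G} -> C) (k : C) :
    {set {set G}} :=
  [set e in edges G | c e == k].

Definition colours (G : sgraph) (C : eqType) (c : {set G} -> C) : seq C :=
  undup [seq c e | e in edges G].

Definition is_star (T : finType) (F : {set {set T}}) : Prop :=
  exists (x : T) (L : {set T}),
    [/\ x \notin L, L != set0 & F = [set [set x; y] | y in L]].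

Definition star_colouring (G : sgraph) (C : eqType) (c : {set G} -> C) : Prop :=
  {in colours c, forall k, is_star (colour_class c k)}.

(* A copy of H in G is a not necessarily induced subgraph of G isomorphic to H,
   given by an embedding f. *)
Definition has_rainbow_copy (H G : sgraph) (C : eqType) (c : {set G} -> C) :
    Prop :=
  exists f : H -> G,
    [/\ injective f,
        {in edges H, forall e : {set H}, f @: e \in edges G} &
        {in edges H &, injective (fun e : {set H} => c (f @: e))}].

Definition ar_star_attained (n : nat) (H : sgraph) (s : nat) : Prop :=
  exists c : {set complete_graph n} -> nat,
    [/\ star_colouring c, size (colours c) = s & ~ has_rainbow_copy H c].

(* [is_ar_star n H s] means that the maximum ar^*(n, H) exists and equals s. *)
Definition is_ar_star (n : nat) (H : sgraph) (s : nat) : Prop :=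
  ar_star_attained n H s /\ (forall t, ar_star_attained n H t -> t <= s).

Definition same_up_to_renaming (G : sgraph) (C C' : eqType)
    (c : {set G} -> C) (c' : {set G} -> C') : Prop :=
  exists2 phi : C' -> C,
    {in colours c' &, injective phi} &
    {in edges G, forall e, c e = phi (c' e)}.

(* An ordering v_1, ..., v_n; the values of v outside 1..n are irrelevant. *)
Definition is_ordering (n : nat) (v : nat -> 'I_n) : Prop :=
  {in [pred i | 1 <= i <= n] &, injective v}.

(* For e = {v_i, v_j} this is min(i, j). *)
Definition min_colouring (n : nat) (v : nat -> 'I_n) (e : {set 'I_n}) : nat :=
  \big[minn/n]_(1 <= i < n.+1 | v i \in e) i.

(* For an edge e of the graph with edge set J, the vertex set of the component
   of that graph containing e. *)
Definition component (T : finType) (J : {set {set T}}) (e : {set T}) : {set T} :=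
  [set y | [exists x in e, connect (fun x y => [set x; y] \in J) x y]].

(* The new colours, disjoint from the old ones, are indexed by the components. *)
Definition recolour (T : finType) (C : eqType) (c : {set T} -> C)
    (J : {set {set T}}) (e : {set T}) : (C + {set T})%type :=
  if e \in J then inr (component J e) else inl (c e).

Inductive extremal_graph (n : nat) (v : nat -> 'I_n) : {set {set 'I_n}} -> Prop :=
| ExtremalOdd (m : nat) :
    n = 2 * m + 1 ->
    extremal_graph v
      (\bigcup_(1 <= k < m.+1) [set [set v (2 * k - 1); v (2 * k)]])
| ExtremalEven (m a : nat) (S : {set {set 'I_n}}) :
    n = 2 * m -> 4 <= n ->
    3 <= 2 * a + 1 <= n - 1 ->
    S \subset pairs [set v (2 * a - 1); v (2 * a); v (2 * a + 1)] ->
    1 <= #|S| <= 2 ->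
    extremal_graph v
      ((\bigcup_(1 <= k < a) [set [set v (2 * k - 1); v (2 * k)]])
       :|: S
       :|: (\bigcup_(a.+1 <= k < m) [set [set v (2 * k); v (2 * k + 1)]]))
| ExtremalTwo :
    n = 2 -> extremal_graph v set0.

Definition has_extremal_structure (n : nat) (C : eqType)
    (c : {set complete_graph n} -> C) : Prop :=
  exists (v : nat -> 'I_n) (J : {set {set 'I_n}}),
    [/\ is_ordering v, extremal_graph v J &
        @same_up_to_renaming (complete_graph n) _ _ c
          (recolour (min_colouring v) J)].

(* Main.v *)
(** Call a colour of a star-colouring _own_ to v if all its edges contain v. Three own colours at
v, on edges vx, vy, vz, would force the triangle xyz to be monochromatic, so every vertex has at
most two, and deleting v loses at most two colours.

If every vertex of a set U has two own colours, then U has a dominating pair {x, y}: the edge xy,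
the edges from x to the rest and the edges from y to the rest carry three different constant
colours.  If some v is the centre of two stars of at least two edges, whose sets of leaves are A
and B, the hypothesis is inherited by A :|: B, where induction gives a dominating pair; but no
triangle meeting both A and B is rainbow.  Otherwise every vertex is on an edge whose colour is
used once; two disjoint such edges are comparable (one dominates the other), comparability has
no 3-cycle, and a maximal edge dominates everything.  Peeling off dominating pairs describes U
completely, and |U| is odd.

For the bound, either peel off a dominating pair (3 colours for 2 vertices) or delete a vertex
with at most one own colour.  For equality with n odd every vertex has two own colours; with n even
some vertex u has exactly one, the others form an extremal odd configuration, and u is either
dominated by its first pair {x, y}, or forms with it the triple carrying the graph S. *)

Require Import Defs.
From mathcomp Require Import all_boot zify.

Set Implicit Arguments.
Unset Strict Implicit.
Unset Printing Implicit Defensive.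

(** * Extremal orderings of indices *)

(* The extremal orderings are read as lists indexed from 0: [p] is the index of the first vertex of
   the triple (there is none if [p] exceeds the length), [lead p i] the first index of the pair or
   triple containing [i], and [S] selects the edges of J inside the triple. *)
Definition lead p i :=
  if i < p then i./2.*2 else if i < p.+3 then p else i.-1./2.*2.+1.

(** The arguments are offsets [i < j] inside the triple, so [b1], [b2], [b3] stand for its edges 01,
    02 and 12. *)
Definition sel (b1 b2 b3 : bool) i j := if i == 0 then (if j == 1 then b1 else b2) else b3.

Definition joined p (S : nat -> nat -> bool) i j :=
  (lead p i == lead p j) && ((p <= i < p.+3) ==> S (i - p) (j - p)).

(* For [i < j], the colour of v_i v_j: a component of J, named by its first index, or min(i, j). *)
Definition key p S i j : nat + nat := if joined p S i j then inr (lead p i) else inl i.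

Definition shift_key b (k : nat + nat) : nat + nat :=
  match k with inl i => inl (b + i) | inr i => inr (b + i) end.

Lemma shift_key_inj b : injective (shift_key b).
Proof. by case=> i [] j //= []; [move/addnI-> | move/addnI->]. Qed.

Lemma lead_pair p k : lead p.+2 (2 + k) = 2 + lead p k.
Proof.
rewrite /lead; case: (ltnP k p) => h1; case: (ltnP k p.+3) => h2;
  case: (ltnP (2 + k) p.+2) => h3; case: (ltnP (2 + k) p.+2.+3) => h4; lia.
Qed.

Lemma key_pair p S i j : key p.+2 S (2 + i) (2 + j) = shift_key 2 (key p S i j).
Proof.
have D k : 2 + k - p.+2 = k - p by lia.
have B : (p.+2 <= 2 + i < p.+2.+3) = (p <= i < p.+3) by lia.
by rewrite /key /joined !lead_pair eqn_add2l B !D; case: ifP.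
Qed.

(** By [n <= p] the tail consists of pairs only. These start at even positions, hence at odd ones
    once three vertices are put in front, which is what the last branch of [lead] describes. *)
Lemma key_triple p S S' n i j : i < j < n -> n <= p ->
  key 0 S (3 + i) (3 + j) = shift_key 3 (key p S' i j).
Proof.
move=> /andP[ij jn] np.
have E k : k < n -> lead 0 (3 + k) = 3 + lead p k.
  by move=> kn; rewrite /lead (leq_trans kn np) /=; lia.
have hi : i < p by lia.
have Ei := E i (ltn_trans ij jn); have Ej := E j jn.
by rewrite /key /joined Ei Ej eqn_add2l [p <= i]leqNgt hi /= !andbT; case: ifP.
Qed.

(** * Own colours and dominating pairs *)

Section LocalColouring.

Variables (T K : finType) (d : T -> T -> K).

(** A set of pairwise intersecting edges is a star or a triangle, so these conditions on single
    edges say that every colour class is a star. *)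
Definition local_star : Prop :=
  [/\ forall x y, d x y = d y x,
      forall x y z w, x != y -> z != w -> d x y = d z w ->
        [|| x == z, x == w, y == z | y == w] &
      forall x y z, x != y -> y != z -> x != z ->
        d x y = d y z -> d x z = d y z -> False].

(** The missing edge of the copy is [xw]; [y] and [z] are its vertices of degree three. *)
Definition no_rainbow : Prop :=
  forall x y z w, uniq [:: x; y; z; w] ->
    ~~ uniq [:: d x y; d x z; d y z; d y w; d z w].

Definition cols (U : {set T}) : {set K} :=
  [set k | [exists x in U, exists y in U, (x != y) && (d x y == k)]].

Definition own (U : {set T}) (v : T) : {set K} := cols U :\: cols (U :\ v).

Definition full (U : {set T}) : Prop := {in U, forall v, 1 < #|own U v|}.

Definition dominating (U : {set T}) (x y : T) : Prop :=
  [/\ x \in U, y \in U, x != y,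
      {in U :\ x :\ y &, forall z w, d x z = d x w /\ d y z = d y w} &
      {in U :\ x :\ y, forall z, uniq [:: d x y; d x z; d y z]}].

Implicit Types (U W : {set T}) (x y z w v a b t : T).

Hypotheses (star : local_star) (noK : no_rainbow).

Let dC x y : d x y = d y x. Proof. by case: star. Qed.

Lemma colsP U k :
  reflect (exists x y, [/\ x \in U, y \in U, x != y & d x y = k]) (k \in cols U).
Proof.
rewrite inE; apply: (iffP exists_inP) => [[x xU /exists_inP[y yU]]|].
  by case/andP=> nxy /eqP e; exists x, y.
by move=> [x [y [xU yU nxy <-]]]; exists x => //; apply/exists_inP; exists y; rewrite ?nxy ?eqxx.
Qed.

Lemma colsI U x y : x \in U -> y \in U -> x != y -> d x y \in cols U.
Proof. by move=> xU yU nxy; apply/colsP; exists x, y. Qed.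

Lemma cols_sub U W : U \subset W -> cols U \subset cols W.
Proof.
move=> /subsetP s; apply/subsetP => k /colsP[x [y [xU yU n <-]]].
by apply: colsI => //; apply: s.
Qed.

Lemma disjoint_neq x y z w : x != y -> z != w -> x != z -> x != w -> y != z -> y != w ->
  d x y <> d z w.
Proof.
move=> nxy nzw /negPf a /negPf b /negPf e /negPf f E; case: star => _ h _.
by have := h _ _ _ _ nxy nzw E; rewrite a b e f.
Qed.

Lemma triangle_not_mono x y z : x != y -> y != z -> x != z ->
  d x y = d y z -> d x z = d y z -> False.
Proof. by case: star => _ _ h; apply: h. Qed.

Lemma noK_neq x y z w : x != y -> x != z -> x != w -> y != z -> y != w -> z != w ->
  d x y <> d x z -> d x y <> d y z -> d x y <> d y w -> d x y <> d z w ->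
  d x z <> d y z -> d x z <> d y w -> d x z <> d z w ->
  d y z <> d y w -> d y z <> d z w -> d y w <> d z w -> False.
Proof.
move=> ? ? ? ? ? ? /eqP h1 /eqP h2 /eqP h3 /eqP h4 /eqP h5 /eqP h6 /eqP h7 /eqP h8 /eqP h9 /eqP h10.
have /negP : ~~ uniq [:: d x y; d x z; d y z; d y w; d z w].
  by apply: noK; rewrite /= !inE !negb_or; do ?[apply/andP; split].
by case; rewrite /= !inE !negb_or; do ?[apply/andP; split].
Qed.

Definition own_edge U v y := d v y \notin cols (U :\ v).

Lemma own_edgeE U v y z w : own_edge U v y -> z \in U -> w \in U -> z != v -> w != v ->
  z != w -> d z w <> d v y.
Proof.
move=> /negP f zU wU zv wv zw E; apply: f; rewrite -E; apply: colsI => //.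
  by rewrite !inE zv.
by rewrite !inE wv.
Qed.

Lemma own_edgeI U v y :
  (forall z w, z \in U -> w \in U -> z != v -> w != v -> z != w -> d z w <> d v y) ->
  own_edge U v y.
Proof.
move=> h; apply/negP => /colsP[z [w [/setD1P[zv zU] /setD1P[wv wU] zw E]]].
exact: (h z w).
Qed.

Lemma ownP U v k : v \in U ->
  reflect (exists y, [/\ y \in U, y != v, d v y = k & own_edge U v y]) (k \in own U v).
Proof.
move=> vU; rewrite in_setD; apply: (iffP andP) => [[nk /colsP[x [y [xU yU xy E]]]]|].
  case: (eqVneq x v) => [xv|xv].
    by subst v; exists y; split=> //; rewrite 1?eq_sym // /own_edge E.
  case: (eqVneq y v) => [yv|yv].
    by subst v; exists x; split=> //; rewrite /own_edge dC ?E.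
  case/negP: nk; rewrite -E; apply: colsI => //.
    by rewrite !inE xv.
  by rewrite !inE yv.
move=> [y [yU yv <- f]]; split=> //; apply: colsI => //; by rewrite eq_sym.
Qed.

Lemma not_own_edgeP U v y : ~~ own_edge U v y ->
  exists z w, [/\ z \in U, w \in U, z != v, w != v & z != w /\ d z w = d v y].
Proof.
rewrite negbK => /colsP[z [w [/setD1P[zv zU] /setD1P[wv wU] zw E]]].
by exists z, w.
Qed.

(* [cneq] separates the colours of two edges that are disjoint, or one of which is own to an
   endpoint missed by the other. *)
Ltac vneq := first [assumption | rewrite eq_sym; assumption].
Ltac cneq1 := first
  [ assumption
  | apply: disjoint_neq; vneq
  | match goal with f : is_true (own_edge _ ?v ?y) |- _ <> d ?v ?y =>
      apply: (own_edgeE f); vneq end ].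
Ltac cneq2 := first [cneq1 | apply: nesym; cneq1].
Ltac cneq := match goal with |- d ?a ?b <> d ?p ?q => first
  [ cneq2
  | rewrite (dC a b); cneq2
  | rewrite (dC p q); cneq2
  | rewrite (dC a b) (dC p q); cneq2 ] end.
Ltac rainbow x y z w := apply: (@noK_neq x y z w); first [vneq | cneq | idtac].

(** In the copy of $K_4^-$ without [xz] the edges at [v] have three different own colours, so [xy]
    and [yz] agree; the copy without [xy] gives that [xz] and [yz] agree. The triangle is
    monochromatic. *)
Lemma own3 U v x y z : v \in U -> x \in U -> y \in U -> z \in U ->
  x != v -> y != v -> z != v -> own_edge U v x -> own_edge U v y -> own_edge U v z ->
  d v x <> d v y -> d v x <> d v z -> d v y <> d v z -> False.
Proof.
move=> vU xU yU zU xv yv zv fx fy fz Nxy Nxz Nyz.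
have xy : x != y by apply/eqP=> e; apply: Nxy; rewrite e.
have xz : x != z by apply/eqP=> e; apply: Nxz; rewrite e.
have yz : y != z by apply/eqP=> e; apply: Nyz; rewrite e.
apply: (@triangle_not_mono x y z) => //.
  by apply/eqP/negPn/negP => /eqP N; rainbow x v y z.
by apply/eqP/negPn/negP => /eqP N; rainbow x v z y.
Qed.

Lemma cols_own U v : #|cols U| = #|cols (U :\ v)| + #|own U v|.
Proof. by rewrite -(cardsID (cols (U :\ v)) (cols U)) (setIidPr (cols_sub _)) // subD1set. Qed.

(** Every other edge of [U] misses [x] or [y], so a colour own to both ends is used on [xy]
    alone. *)
Definition single U x y := [&& x \in U, y \in U, x != y, own_edge U x y & own_edge U y x].

Lemma singleC U x y : single U x y = single U y x.
Proof.
rewrite /single eq_sym; case: (x \in U); case: (y \in U) => //=.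
by case: (_ != _) => //=; rewrite andbC.
Qed.

Lemma eq_or_eq (k1 k2 k3 k4 : K) : (k1 <> k2 -> k3 <> k4 -> False) -> k1 = k2 \/ k3 = k4.
Proof.
move=> h; case: (eqVneq k1 k2) => [|/eqP n1]; [by left | right].
by apply/eqP/negPn/negP => /eqP; exact: h.
Qed.

(** A path formed by three of the four cross edges makes a copy of $K_4^-$ with [ab] and [zw]. The
    end edges of the path are disjoint, so its middle edge has the colour of one of them. Three such
    paths leave only the two alternatives. *)
Lemma comparable U a b z w : single U a b -> single U z w ->
  a != z -> a != w -> b != z -> b != w ->
  (d a z = d a w /\ d b z = d b w) \/ (d z a = d z b /\ d w a = d w b).
Proof.
move=> /and5P[aU bU ab fa fb] /and5P[zU wU zw fz fw] az aw bz bw.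
have Na : d b a <> d z w by cneq.
have h1 : d a z = d a w \/ d a z = d b z.
  apply: eq_or_eq => n1 n2.
  by rainbow b a z w.
have h2 : d a z = d a w \/ d a w = d b w.
  apply: eq_or_eq => n1 n2.
  by rainbow b a w z.
have h3 : d b z = d b w \/ d a z = d b z.
  apply: eq_or_eq => n1 n2.
  by rainbow a b z w.
have X : d a z <> d b w by cneq.
have Y : d a w <> d b z by cneq.
rewrite (dC z a) (dC z b) (dC w a) (dC w b).
by intuition congruence.
Qed.

Lemma uniq3P (k1 k2 k3 : K) :
  uniq [:: k1; k2; k3] -> [/\ k1 <> k2, k1 <> k3 & k2 <> k3].
Proof. by rewrite /= !inE negb_or andbT => /andP[/andP[/eqP ? /eqP ?] /eqP ?]. Qed.

(** * Existence of a dominating pair *)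

Lemma own_edgeS U W v x : W \subset U -> own_edge U v x -> own_edge W v x.
Proof. by move=> s; apply: contra; apply: (subsetP (cols_sub _)); apply: setSD. Qed.

(** Since the edge is not single, its colour occurs on an edge missing [x]; since the colour is own
    to [v], that edge contains [v]. *)
Lemma second_leaf U v x : v \in U -> x \in U -> x != v -> own_edge U v x -> ~~ single U v x ->
  exists y, [/\ y \in U, y != v, y != x & d v y = d v x].
Proof.
move=> vU xU xv fx; rewrite /single vU xU fx eq_sym xv /=.
case/not_own_edgeP=> z [w [zU wU zx wx [zw E]]].
rewrite [d x v]dC in E.
case: (eqVneq z v) => [zv|zv]; first by subst z; exists w; split; rewrite // eq_sym.
case: (eqVneq w v) => [wv|wv]; first by subst w; exists z; split; rewrite // dC.
by case: (own_edgeE fx zU wU zv wv zw).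
Qed.

(* [W] is the union of the leaves of the two stars; an edge from [W] to a vertex outside [W] either
   is not own or has the colour of an edge inside [W], so [W] is full again. *)
Lemma two_stars U v : full U -> v \in U -> (forall x, ~~ single U v x) ->
  (forall W, W \proper U -> full W -> W != set0 -> exists x y, dominating W x y) -> False.
Proof.
move=> fU vU ns IH.
have /card_gt1P[k1 [k2 []]] := fU v vU.
move=> /(ownP _ vU)[a [aU av <- fa]] /(ownP _ vU)[b [bU bv <- fb]] /eqP ab.
pose W := [set x in U :\ v | (d v x == d v a) || (d v x == d v b)].
have WP x : reflect [/\ x \in U, x != v & d v x = d v a \/ d v x = d v b] (x \in W).
  rewrite !inE; apply: (iffP andP) => [[/andP[-> ->]] /orP[/eqP->|/eqP->]|[-> -> o]].
  - by split=> //; left.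
  - by split=> //; right.
  - by split=> //; case: o => ->; rewrite eqxx ?orbT.
have Wf x : x \in W -> own_edge U v x.
  by case/WP=> _ _ [] e; rewrite /own_edge e.
have Wleaf x : x \in W -> exists y, [/\ y \in W, y != x & d v y = d v x].
  move=> xW; have /WP[xU xv o] := xW.
  have [y [yU yv yx E]] := second_leaf vU xU xv (Wf x xW) (ns x).
  by exists y; split=> //; apply/WP; rewrite E.
have Wother x : x \in W -> exists y, [/\ y \in W & d v y <> d v x].
  case/WP=> xU xv [] ->.
    by exists b; split; [apply/WP; split=> //; right | move/esym].
  by exists a; split=> //; apply/WP; split=> //; left.
have sWU : W \subset U by apply/subsetP => x /WP[].
have fW : full W.
  move=> x xW; apply: leq_trans (fU x (subsetP sWU x xW)) _.
  apply/subset_leq_card/subsetP => k; have /WP[xU xv _] := xW.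
  have [y [yW Nxy]] := Wother x xW; have /WP[yU yv _] := yW.
  have yx : y != x by apply/eqP => e; apply: Nxy; rewrite e.
  case/(ownP _ xU) => t [tU tx <- ft]; apply/(ownP _ xW).
  case: (boolP (t \in W)) => [tW|tW].
    by exists t; split=> //; apply: own_edgeS ft.
  case: (eqVneq t v) => [tv|tv].
    subst t; have [x' [x'W x'x E]] := Wleaf x xW; have /WP[x'U x'v _] := x'W.
    by case: (own_edgeE ft vU x'U tx x'x); rewrite 1?eq_sym // E dC.
  have fx := Wf x xW; have fy := Wf y yW.
  have Nt z : z \in W -> d v z <> d v t.
    by case/WP=> _ _ o e; case/negP: tW; apply/WP; rewrite -e; split.
  have Ntx := Nt x xW; have Nty := Nt y yW.
  have ty : t != y by apply/eqP => e; apply: Nty; rewrite e.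
  have E : d x t = d x y.
    by apply/eqP/negPn/negP => /eqP N; rainbow y v x t.
  by exists y; split=> //; rewrite /own_edge -E; apply: own_edgeS ft.
have W0 : W != set0 by apply/set0Pn; exists a; apply/WP; split=> //; left.
have prop : W \proper U.
  rewrite properE sWU; apply/subsetPn; exists v => //.
  by apply/negP => /WP[_]; rewrite eqxx.
have [x [y [xW yW xy _ R]]] := IH W prop fW W0.
have /WP[xU xv _] := xW; have /WP[yU yv _] := yW.
have fx := Wf x xW; have fy := Wf y yW.
(* A third vertex [z] is chosen so that the triangle [xyz] meets both stars. It is rainbow by
   domination, and [v] joined to two of its vertices from different stars completes a rainbow
   copy. *)
case: (eqVneq (d v x) (d v y)) => [E|/eqP N].
  have [z [zW Nzx]] := Wother x xW; have /WP[zU zv _] := zW; have fz := Wf z zW.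
  have zx : z != x by apply/eqP => e; apply: Nzx; rewrite e.
  have zy : z != y by apply/eqP => e; apply: Nzx; rewrite e E.
  have /uniq3P[n1 n2 n3] : uniq [:: d x y; d x z; d y z] by apply: R; rewrite !in_setD1 zx zy zW.
  by rainbow v x z y.
have [z [zW zx E]] := Wleaf x xW; have /WP[zU zv _] := zW; have fz := Wf z zW.
have zy : z != y by apply/eqP => e; apply: N; rewrite -e E.
have /uniq3P[n1 n2 n3] : uniq [:: d x y; d x z; d y z] by apply: R; rewrite !in_setD1 zx zy zW.
by rainbow v x y z.
Qed.

(** These are the leaves of the stars with at least two edges centred at [v]. Their number is the
    quantity maximised when a single edge is chosen in [full_dominating]. *)
Definition multi (U : {set T}) (v : T) : {set T} :=
  [set x in U | (x != v) && [exists y in U, [&& y != x, y != v & d v x == d v y]]].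

Lemma multiP U v x :
  reflect (exists y, [/\ x \in U, y \in U, x != v, y != v & y != x /\ d v x = d v y])
          (x \in multi U v).
Proof.
rewrite inE; apply: (iffP and3P) => [[xU xv /exists_inP[y yU /and3P[yx yv /eqP E]]]|].
  by exists y.
move=> [y [xU yU xv yv [yx E]]]; split=> //; apply/exists_inP; exists y => //.
by rewrite yx yv E eqxx.
Qed.

(* If a disjoint single edge [zw] dominated [ab], then [multi U z] would contain [multi U a] and
   also [a], which is not in [multi U a]. *)
Lemma single_max U a b : (forall v, v \in U -> exists x, single U v x) ->
  single U a b -> (forall z w, single U z w -> #|multi U z| <= #|multi U a|) ->
  forall z w, single U z w -> a != z -> a != w -> b != z -> b != w ->
  d a z = d a w /\ d b z = d b w.
Proof.
move=> cov sab mx z w szw az aw bz bw.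
case: (comparable sab szw az aw bz bw) => [//|[Ez Ew]]; exfalso.
suff : multi U a \proper multi U z by move/proper_card; rewrite ltnNge (mx _ _ szw).
have /and5P[aU bU ab fa fb] := sab; have /and5P[zU wU zw fz fw] := szw.
rewrite properE; apply/andP; split; last first.
  apply/subsetPn; exists a; last by apply/multiP => -[y []]; rewrite eqxx.
  by apply/multiP; exists b; split; rewrite // 1?eq_sym.
apply/subsetP => t /multiP[t' [tU t'U ta t'a [t't Et]]].
case: (eqVneq t b) => [->|tb].
  by apply/multiP; exists a; split; rewrite // 1?eq_sym.
have t'b : t' != b.
  apply/eqP => e; subst t'; have : d t a <> d b a by cneq.
  by rewrite dC Et dC.
have tz : t != z.
  apply/eqP => e; subst t; have : d a t' <> d z b by cneq.
  by rewrite -Et dC.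
have tw : t != w.
  apply/eqP => e; subst t; have : d a t' <> d w b by cneq.
  by rewrite -Et dC.
have nta : d t a <> d t b.
  have : d a t' <> d t b by cneq.
  by rewrite -Et dC.
(* The single edge [ts] is to be compared with both [ab] and [zw]; the cases where [s] is an end of
   one of them come first. *)
have [s sts] := cov t tU; have /and5P[_ sU ts ft fs] := sts.
case: (eqVneq s a) => [e|sa].
  by subst s; have [] : d a t' <> d t a; [cneq | rewrite -Et dC].
case: (eqVneq s b) => [e|sb].
  subst s; case: (comparable sts szw) => // [[_ E]|[E _]].
    by have [] : d z a <> d w b; [cneq | rewrite Ez dC E dC].
  by apply/multiP; exists b; split; rewrite // 1?eq_sym.
case: (eqVneq s z) => [e|sz].
  subst s; case: (comparable sts sab) => //; rewrite 1?eq_sym // => -[E _] //.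
  by have [] : d a t <> d z b; [cneq | rewrite E -Ez dC].
case: (eqVneq s w) => [e|sw].
  subst s; case: (comparable sts sab) => //; rewrite 1?eq_sym // => -[E _] //.
  by have [] : d a t <> d w b; [cneq | rewrite E -Ew dC].
case: (comparable sts sab) => // -[E1 E2] //.
case: (comparable sts szw) => // -[E3 E4]; last first.
  by apply/multiP; exists s; split; rewrite // 1?eq_sym.
(* Now [ab] dominates [ts], [ts] dominates [zw] and [zw] dominates [ab]. This cycle makes the copy
   on [t], [z], [a], [w] without [tw] rainbow. *)
exfalso.
have n1 : d t a <> d t z by rewrite dC E1; cneq.
have n2 : d t z <> d z a by rewrite E3; cneq.
have n3 : d t a <> d z a by rewrite Ez; cneq.
have n4 : d t a <> d w a by rewrite Ew; cneq.
have n5 : d z a <> d a w by rewrite Ez; cneq.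
by rainbow t z a w.
Qed.

(** An edge of this colour missing [v] meets both [vx] and [vy], so it is [xy] and closes a
    monochromatic triangle. *)
Lemma cherry_own_edge U v x y : x != v -> y != v -> x != y -> d v x = d v y -> own_edge U v x.
Proof.
move=> xv yv xy E; apply: own_edgeI => z w _ _ zv wv zw F.
case: (eqVneq z x) => [zx|zx].
  subst z; case: (eqVneq w y) => [wy|wy].
    by subst w; apply: (@triangle_not_mono v x y); first [vneq | congruence].
  by have [] : d x w <> d v y; [cneq | rewrite F].
case: (eqVneq w x) => [wx|wx]; last by have [] : d z w <> d v x by cneq.
subst w; case: (eqVneq z y) => [zy|zy].
  by subst z; rewrite dC in F; apply: (@triangle_not_mono v x y); first [vneq | congruence].
by have [] : d z x <> d v y; [cneq | rewrite F].
Qed.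

(** Let [ts] be a single edge at a fourth vertex [t]. If [s] is [b] or [z], three single edges form
    a path, which gives a rainbow copy. Otherwise [at] has a third own colour at [a], directly if
    [s] is [a], and through [H] and [cherry_own_edge] if not. *)
Lemma single_branch U a b z : (forall v, v \in U -> exists x, single U v x) ->
  single U a b ->
  (forall x y, single U x y -> a != x -> a != y -> b != x -> b != y -> d a x = d a y) ->
  single U a z -> z != b -> {subset U <= [:: a; b; z]}.
Proof.
move=> cov sab H saz zb t tU; rewrite !inE; apply/negPn/negP; rewrite !negb_or.
case/and3P=> ta tb tz; have [s sts] := cov t tU.
have /and5P[aU bU ab fa fb] := sab; have /and5P[_ zU az faz fza] := saz.
have /and5P[_ sU ts ft fs] := sts.
case: (eqVneq s a) => [e|sa].
  by subst s; apply: (own3 aU bU zU tU); first [vneq | cneq].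
case: (eqVneq s b) => [e|sb]; first by subst s; rainbow t b a z.
case: (eqVneq s z) => [e|sz]; first by subst s; rainbow b a z t.
have E : d a t = d a s by apply: H; rewrite // eq_sym.
have fat : own_edge U a t by apply: (cherry_own_edge U ta sa ts E).
by apply: (own3 aU bU zU tU); first [vneq | cneq].
Qed.

Lemma dominating_branch U a b z : single U a b -> single U a z -> z != b ->
  {subset U <= [:: a; b; z]} -> dominating U a b.
Proof.
move=> /and5P[aU bU ab fa fb] /and5P[_ zU az faz fza] zb s.
have Ez x : x \in U :\ a :\ b -> x = z.
  by rewrite !inE => /and3P[xb xa /s]; rewrite !inE (negPf xb) (negPf xa) => /eqP.
split=> // [x y /Ez-> /Ez-> //|x /Ez->].
rewrite /= !inE negb_or andbT -andbA; apply/and3P; split; apply/eqP; cneq.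
Qed.

Lemma dominatingC U x y : dominating U x y -> dominating U y x.
Proof.
case=> xU yU xy H1 H2; split; rewrite // 1?eq_sym //.
  by move=> z w; rewrite !(setDDl, setUC [set y]) -setDDl => zU wU; case: (H1 z w).
move=> z; rewrite !(setDDl, setUC [set y]) -setDDl => /H2 /uniq3P[a b c].
by rewrite /= !inE negb_or andbT -andbA; apply/and3P; split; apply/eqP; cneq.
Qed.

Lemma full_dominating U : full U -> U != set0 -> exists x y, dominating U x y.
Proof.
have [n] := ubnP #|U|; elim: n U => // n IHn U Un fU /set0Pn[u uU].
have IH W : W \proper U -> full W -> W != set0 -> exists x y, dominating W x y.
  by move=> /proper_card WU; apply: IHn; apply: leq_trans WU _.
case: (boolP [forall v in U, exists x, single U v x]); last first.
  case/forall_inPn => v vU; rewrite negb_exists => /forallP ns.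
  by case: (two_stars fU vU ns IH).
move/forall_inP=> cov'; have cov v : v \in U -> exists x, single U v x.
  by move/cov'/existsP.
have [u' suu'] := cov u uU.
pose P := [pred p : T * T | single U p.1 p.2].
have Pu : P (u, u') by [].
(* The maximum runs over ordered pairs, so [a] is the end of the edge that is measured. *)
case: (arg_maxnP (fun p => #|multi U p.1|) Pu) => -[a b] /= sab mx.
have mx' z w : single U z w -> #|multi U z| <= #|multi U a| by move=> szw; apply: (mx (z, w)).
have H := single_max cov sab mx'.
have sba : single U b a by rewrite singleC.
have /and5P[aU bU ab fa fb] := sab.
case: (boolP [exists z, single U a z && (z != b)]) => [/existsP[z /andP[saz zb]]|na].
  exists a, b; apply: (dominating_branch sab saz zb).
  by apply: single_branch saz zb => // x y sxy n1 n2 n3 n4; case: (H x y).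
case: (boolP [exists z, single U b z && (z != a)]) => [/existsP[z /andP[sbz za]]|nb].
  exists b, a; apply: (dominating_branch sba sbz za).
  by apply: single_branch sbz za => // x y sxy n1 n2 n3 n4; case: (H x y).
(* No single edge other than [ab] meets [a] or [b], so all remaining vertices lie on single edges
   disjoint from [ab], and [ab] dominates each of those. *)
have pair z : z \in U :\ a :\ b -> exists w,
    [/\ [/\ z \in U, w \in U, z != w & single U z w], z != a, z != b, w != a & w != b] /\
    (d a z = d a w /\ d b z = d b w).
  rewrite !inE => /and3P[zb za zU]; have [w szw] := cov z zU.
  have /and5P[_ wU zw _ _] := szw; exists w.
  have wa : w != a.
    apply: contraNneq nb => e; subst w; case/negP: na; apply/existsP; exists z.
    by rewrite singleC szw zb.
  have wb : w != b.
    apply: contraNneq nb => e; subst w; apply/existsP; exists z.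
    by rewrite singleC szw za.
  by split=> //; apply: H; rewrite // eq_sym.
exists a, b; split=> // [z w|z].
  case/pair=> z' [[[zU z'U zz' szz'] za zb z'a z'b] [Ea Eb]].
  case/pair=> w' [[[wU w'U ww' sww'] wa wb w'a w'b] [Fa Fb]].
  have faz : own_edge U a z := cherry_own_edge U za z'a zz' Ea.
  have fbz : own_edge U b z := cherry_own_edge U zb z'b zz' Eb.
  have faw : own_edge U a w := cherry_own_edge U wa w'a ww' Fa.
  have fbw : own_edge U b w := cherry_own_edge U wb w'b ww' Fb.
  (* Two colours at [a] towards the rest would, together with that of [ab], be three own colours at
     [a]; likewise at [b]. *)
  split; apply/eqP/negPn/negP => /eqP N.
    by apply: (own3 aU bU zU wU); first [vneq | cneq].
  by apply: (own3 bU aU zU wU); first [vneq | cneq].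
case/pair=> z' [[[zU z'U zz' szz'] za zb z'a z'b] [Ea Eb]].
rewrite /= !inE negb_or andbT -andbA; apply/and3P; split; apply/eqP; last rewrite Ea; cneq.
Qed.

(** * Counting colours *)

Lemma dominating_rest U x y z : z \in U :\ x :\ y ->
  [/\ z \in U, z != x & z != y].
Proof. by rewrite !inE => /and3P[]. Qed.

Lemma card_rest U x y : x \in U -> y \in U -> x != y -> #|U| = #|U :\ x :\ y|.+2.
Proof. by move=> xU yU xy; rewrite (cardsD1 x U) xU (cardsD1 y) !inE eq_sym xy yU. Qed.

(** For [z] in a rest with a second vertex [w], the colours of [zx] and [zy] occur on [wx] and [wy]
    too. So the own colours of [z] lie on edges inside the rest and remain own there. *)
Lemma full_rest U x y : full U -> dominating U x y ->
  let R := U :\ x :\ y in R != set0 /\ (#|R| = 1 \/ full R).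
Proof.
move=> fU [xU yU xy H _] R.
have R0 : R != set0.
  have /card_gt1P[k1 [k2 [/(ownP _ xU)[a [aU ax <- _]] /(ownP _ xU)[b [bU bx <- _]] N]]] := fU x xU.
  case: (eqVneq a y) => [ay|ay]; last by apply/set0Pn; exists a; rewrite !inE ay ax.
  case: (eqVneq b y) => [bY|bY]; last by apply/set0Pn; exists b; rewrite !inE bY bx.
  by rewrite ay bY eqxx in N.
split=> //; case: (ltngtP #|R| 1); [by rewrite ltnNge card_gt0 R0 | move=> R1; right | by left].
move=> z zR; have [zU zx zy] := dominating_rest zR; apply: leq_trans (fU z zU) _.
have [w wR wz] : exists2 w, w \in R & w != z.
  have /card_gt1P[a [b [aR bR ab]]] := R1.
  by case: (eqVneq a z) => [e|]; [exists b; rewrite // -e eq_sym | exists a].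
have [wU wx wy] := dominating_rest wR; have [Ex Ey] := H _ _ zR wR.
apply/subset_leq_card/subsetP => k /(ownP _ zU)[t [tU tz <- ft]]; apply/(ownP _ zR).
have tx : t != x.
  by apply/eqP => e; subst t; have [] : d x w <> d z x; [cneq | rewrite -Ex dC].
have ty : t != y.
  by apply/eqP => e; subst t; have [] : d y w <> d z y; [cneq | rewrite -Ey dC].
exists t; split; rewrite // ?inE ?tx ?ty ?tU //.
by apply: own_edgeS ft; rewrite /R setDDl subDset subsetUr.
Qed.

Lemma full_odd U : U != set0 -> full U -> odd #|U|.
Proof.
have [n] := ubnP #|U|; elim: n U => // n IHn U Un U0 fU.
have [x [y D]] := full_dominating fU U0; have [R0 o] := full_rest fU D.
have [xU yU xy _ _] := D.
move: Un; rewrite (card_rest xU yU xy) /= negbK => /ltnW Un.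
by case: o => [->//|]; apply: IHn.
Qed.

Lemma cols1 U : #|U| <= 1 -> cols U = set0.
Proof.
move=> /card_le1_eqP h; apply/setP => k; rewrite [RHS]inE; apply/negP => /colsP[x [y [xU yU]]].
by rewrite (h x y xU yU) eqxx.
Qed.

Lemma cols_dominating U x y z : dominating U x y -> z \in U :\ x :\ y ->
  #|cols U| <= #|cols (U :\ x :\ y)| + 3.
Proof.
case=> xU yU xy H _ zR.
have s : cols U \subset cols (U :\ x :\ y) :|: [set d x y; d x z; d y z].
  have In w : w \in U -> [\/ w = x, w = y | w \in U :\ x :\ y].
    case: (eqVneq w x) => [|wx]; first by constructor 1.
    case: (eqVneq w y) => [|wy]; first by constructor 2.
    by constructor 3; rewrite !inE wx wy.
  have Ex w : w \in U :\ x :\ y -> d x w = d x z by move=> wR; case: (H w z).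
  have Ey w : w \in U :\ x :\ y -> d y w = d y z by move=> wR; case: (H w z).
  apply/subsetP => k /colsP[a [b [aU bU ab <-]]]; rewrite !in_setU !in_set1.
  case: (In a aU) ab => [->|->|aR]; case: (In b bU) => [->|->|bR]; rewrite ?eqxx //= => ab.
  - by rewrite orbT.
  - by rewrite Ex // eqxx !orbT.
  - by rewrite dC eqxx orbT.
  - by rewrite Ey // eqxx !orbT.
  - by rewrite dC Ex // eqxx !orbT.
  - by rewrite dC Ey // eqxx !orbT.
  - by rewrite colsI.
apply: leq_trans (subset_leq_card s) _; apply: leq_trans (leq_card_setU _ _) _.
rewrite leq_add2l; apply: leq_trans (leq_card_setU _ _) _.
by rewrite cards1 addn1 ltnS cards2; case: (_ != _).
Qed.

Lemma fullPn U : full U \/ exists2 u, u \in U & #|own U u| <= 1.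
Proof.
case: (boolP [forall v in U, 1 < #|own U v|]) => [/forall_inP|/forall_inPn[u uU]]; first by left.
by rewrite -leqNgt; right; exists u.
Qed.

Lemma cols_bound U : #|cols U| <= (3 * (#|U| - 1)) %/ 2.
Proof.
have [n] := ubnP #|U|; elim: n U => // n IHn U Un.
case: (leqP #|U| 1) => [/cols1->|U1]; first by rewrite cards0.
case: (fullPn U) => [fU|[u uU ou]].
  have U0 : U != set0 by rewrite -card_gt0 ltnW.
  have [x [y D]] := full_dominating fU U0; have [/set0Pn[z zR] o] := full_rest fU D.
  have [xU yU xy _ _] := D; have := cols_dominating D zR; have := IHn (U :\ x :\ y).
  have : 0 < #|U :\ x :\ y| by rewrite card_gt0; apply/set0Pn; exists z.
  move: Un; rewrite (card_rest xU yU xy); clear; lia.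
have := IHn (U :\ u); have := cols_own U u.
move: Un U1; rewrite (cardsD1 u U) uU /=; lia.
Qed.

(** Below an odd size the bound drops by two when a vertex is deleted, which a vertex with at most
    one own colour cannot account for. *)
Lemma cols_max_odd U : odd #|U| -> #|cols U| = (3 * (#|U| - 1)) %/ 2 -> #|U| = 1 \/ full U.
Proof.
move=> oU E; case: (fullPn U) => [|[u uU ou]]; [by right | left].
have := cols_bound (U :\ u); have := cols_own U u.
move: oU E; rewrite (cardsD1 u U) uU /=; lia.
Qed.

(** A full set has odd size, so some [u] has at most one own colour. Below an even size the bound
    drops by one, so [u] has exactly one and the rest attains the bound for an odd size. *)
Lemma cols_max_even U : ~~ odd #|U| -> 2 < #|U| -> #|cols U| = (3 * (#|U| - 1)) %/ 2 ->
  exists u, [/\ u \in U, full (U :\ u) & own U u != set0].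
Proof.
move=> oU U2 E; case: (fullPn U) => [fU|[u uU ou]].
  by move: oU; rewrite full_odd // -card_gt0; lia.
have B := cols_bound (U :\ u); have C := cols_own U u.
have S := cardsD1 u U; rewrite uU in S.
have E' : #|cols (U :\ u)| = (3 * (#|U :\ u| - 1)) %/ 2 by lia.
exists u; split=> //; last by rewrite -card_gt0; lia.
by case: (cols_max_odd _ E'); [lia | lia |].
Qed.

(** * Adding a vertex to a full set *)

(** Here [s] is the colour of the edges of $S$, and [g1], [g2], [g3] are the colours from the three
    vertices to [W]. An edge outside $S$ keeps the colour of its earlier end, which is [g1] or
    [g2]. *)
Definition triple (W : {set T}) (x y z : T) (b1 b2 b3 : bool) : Prop :=
  0 < b1 + b2 + b3 < 3 /\
  exists s g1 g2 g3, [/\ uniq [:: s; g1; g2; g3],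
    {in W, forall w, [/\ d x w = g1, d y w = g2 & d z w = g3]},
    d x y = if b1 then s else g1,
    d x z = if b2 then s else g1 &
    d y z = if b3 then s else g2].

Definition has_triple (W : {set T}) (x y z : T) : Prop :=
  exists (x' y' z' : T) (b1 b2 b3 : bool), perm_eq [:: x'; y'; z'] [:: x; y; z] /\
    triple W x' y' z' b1 b2 b3.

Lemma tripleI W x y z (b1 b2 b3 : bool) s g1 g2 g3 : 0 < b1 + b2 + b3 < 3 ->
  s <> g1 -> s <> g2 -> s <> g3 -> g1 <> g2 -> g1 <> g3 -> g2 <> g3 ->
  {in W, forall w, d x w = g1} -> {in W, forall w, d y w = g2} ->
  {in W, forall w, d z w = g3} ->
  d x y = (if b1 then s else g1) -> d x z = (if b2 then s else g1) ->
  d y z = (if b3 then s else g2) -> triple W x y z b1 b2 b3.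
Proof.
move=> b /eqP n1 /eqP n2 /eqP n3 /eqP n4 /eqP n5 /eqP n6 h1 h2 h3 e1 e2 e3.
split=> //; exists s, g1, g2, g3; split=> //.
  by rewrite /= !inE !negb_or; do ?[apply/andP; split].
by move=> w wW; split; [apply: h1 | apply: h2 | apply: h3].
Qed.

Lemma has_tripleC W x y z x' y' z' : perm_eq [:: x'; y'; z'] [:: x; y; z] ->
  has_triple W x' y' z' -> has_triple W x y z.
Proof.
move=> p [a [b [e [b1 [b2 [b3 [p' t]]]]]]]; exists a, b, e, b1, b2, b3; split=> //.
exact: perm_trans p' p.
Qed.

(* A vertex [w] with [d u w <> d u t] sends the colour [d u w] to all vertices [s] with
   [d u s = d u t], and has at most one own colour in [R]. *)
Lemma const_star R u x y X Y : full R -> u \notin R -> x \notin R -> y \notin R ->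
  u != x -> u != y -> x != y ->
  {in R, forall z, d x z = X} -> {in R, forall z, d y z = Y} -> d x y <> X ->
  d u x = d x y ->
  forall t, t \in R -> (forall p q, p \in R -> q \in R -> p != q -> d p q <> d u t) ->
  {in R, forall w, d u w = d u t}.
Proof.
move=> fR uR xR yR ux uy xy HX HY NX Eux t tR ft.
have out a w : a \notin R -> w \in R -> a != w.
  by move=> aR wR; apply: contraNneq aR => ->.
(* If the triangle on [u], [z], [w] were rainbow, it would form a rainbow copy with [xu] and
   [xz]. *)
have tri z w : z \in R -> w \in R -> z != w ->
    [\/ d u z = d u w, d u z = d z w | d u w = d z w].
  move=> zR wR zw.
  have [uz uw xz xw] : [/\ u != z, u != w, x != z & x != w] by split; apply: out.
  have [yz yw] : y != z /\ y != w by split; apply: out.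
  case: (eqVneq (d u z) (d u w)) => [|/eqP n1]; first by constructor 1.
  case: (eqVneq (d u z) (d z w)) => [|/eqP n2]; first by constructor 2.
  case: (eqVneq (d u w) (d z w)) => [|/eqP n3]; first by constructor 3.
  have n4 : d x u <> d x z by rewrite dC Eux (HX z).
  have n5 : d x u <> d u z by rewrite dC Eux; cneq.
  have n6 : d x u <> d u w by rewrite dC Eux; cneq.
  have n7 : d x z <> d u z by rewrite (HX z) // -(HX w) //; cneq.
  have n8 : d x z <> d z w.
    by move=> e; apply: (@triangle_not_mono x z w) => //; rewrite -e (HX z) ?(HX w).
  by exfalso; rainbow x u z w.
move=> w wR; apply/eqP/negPn/negP => /eqP N.
have tw : t != w by apply/eqP => e; subst t.
have uw := out u w uR wR; have ut := out u t uR tR.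
have Ew : d u w = d t w.
  by case: (tri t w tR wR tw) => e //; [rewrite e in N | case: (ft t w)].
suff : own R w \subset [set d u w].
  by move/subset_leq_card; rewrite cards1 leqNgt fR.
apply/subsetP => k /(ownP _ wR)[s [sR sw <- fs]]; rewrite inE; apply/eqP.
case: (eqVneq s t) => [->|st]; first by rewrite Ew dC.
have us := out u s uR sR; have ws : w != s by rewrite eq_sym.
case: (tri w s wR sR ws) => [e|-> //|e].
  case: (eqVneq (d u s) (d u t)) => [e'|/eqP N']; first by rewrite e e' in N.
  have ts : t != s by rewrite eq_sym.
  case: (tri t s tR sR ts) => e'; [by rewrite e' in N' | by case: (ft t s) |].
  by have [] : d u w <> d t s; [cneq | rewrite e e'].
case: (eqVneq (d u s) (d u t)) => [e'|/eqP N']; first by case: (ft w s); rewrite // -e.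
have ts : t != s by rewrite eq_sym.
case: (tri t s tR sR ts) => e'; [by rewrite e' in N' | by case: (ft t s) |].
by have [] : d t s <> d w s; [cneq | rewrite -e'].
Qed.

Lemma perm3 (a b c : T) : [/\ perm_eq [:: b; c; a] [:: a; b; c],
  perm_eq [:: a; c; b] [:: a; b; c] & perm_eq [:: c; b; a] [:: a; b; c]].
Proof. by split; apply/permP => P /=; lia. Qed.

Lemma full_other R z : full R -> z \in R -> exists2 w, w \in R & w != z.
Proof.
move=> fR zR; have /card_gt1P[k [_ [/(ownP _ zR)[w [wR wz _ _]] _ _]]] := fR z zR.
by exists w.
Qed.

Lemma dominatingP U u x y : dominating (U :\ u) x y -> U :\ u :\ x :\ y != set0 ->
  exists X Y,
  [/\ [/\ x \in U, y \in U, x != u, y != u & x != y],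
      [/\ d x y <> X, d x y <> Y & X <> Y],
      {in U :\ u :\ x :\ y, forall z, d x z = X},
      {in U :\ u :\ x :\ y, forall z, d y z = Y} &
      {in U :\ u :\ x :\ y, forall z, [/\ z \in U, z != u, z != x & z != y]}].
Proof.
case=> /setD1P[xu xU] /setD1P[yu yU] xy H1 H2 /set0Pn[r rR].
exists (d x r), (d y r); split=> //.
- by apply: uniq3P; apply: H2.
- by move=> z zR; case: (H1 z r).
- by move=> z zR; case: (H1 z r).
- by move=> z; rewrite !inE => /and4P[].
Qed.

(** For [z] in the rest the triangle [xyz] is rainbow and avoids the own colour of [ux], which
    forces [uz] to have the colour of [ux]. Thus [u] sends a constant colour to the rest, and only
    [uy] is left open. *)
Lemma triple_new U u x y : u \in U -> dominating (U :\ u) x y -> full (U :\ u :\ x :\ y) ->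
  U :\ u :\ x :\ y != set0 -> own_edge U u x -> has_triple (U :\ u :\ x :\ y) u x y.
Proof.
move=> uU D fR R0 fx.
have [X [Y [[xU yU xu yu xy] [n1 n2 n3] HX HY HR]]] := dominatingP D R0.
set R := U :\ u :\ x :\ y in fR R0 HX HY HR *.
have [r rR] := set0Pn _ R0.
have [rU ru rx ry] := HR r rR.
have const z : z \in R -> d u z = d u x.
  move=> zR; have [zU zu zx zy] := HR z zR.
  have [w wR wz] := full_other fR zR; have [wU wu wx wy] := HR w wR.
  have m1 : d x y <> d x z by rewrite (HX z).
  have m2 : d x y <> d y z by rewrite (HY z).
  have m3 : d x z <> d y z by rewrite (HX z) ?(HY z).
  have m4 : d u z <> d x z by rewrite (HX z) // -(HX w) //; cneq.
  have m5 : d u z <> d y z by rewrite (HY z) // -(HY w) //; cneq.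
  by apply/eqP/negPn/negP => /eqP m; rainbow u x z y.
have Ny z : z \in R -> own_edge U u y -> d u z = d u y.
  move=> zR fy; have [zU zu zx zy] := HR z zR.
  have [w wR wz] := full_other fR zR; have [wU wu wx wy] := HR w wR.
  have m1 : d x y <> d x z by rewrite (HX z).
  have m2 : d x y <> d y z by rewrite (HY z).
  have m3 : d x z <> d y z by rewrite (HX z) ?(HY z).
  have m4 : d u z <> d x z by rewrite (HX z) // -(HX w) //; cneq.
  have m5 : d u z <> d y z by rewrite (HY z) // -(HY w) //; cneq.
  by apply/eqP/negPn/negP => /eqP m; rainbow u y z x.
have k1 : d x y <> d u x by cneq.
have k2 : X <> d u x by rewrite -(HX r) //; cneq.
have k3 : Y <> d u x by rewrite -(HY r) //; cneq.
(* The colour of [uy] decides the triple: [y], [u], [x] with $S=\{yx\}$, then [u], [x], [y] with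
   $S=\{uy,xy\}$, and last [u], [x], [y] with $S=\{xy\}$. *)
case: (eqVneq (d u y) Y) => [E|/eqP NY].
  exists y, u, x, false, true, false; split.
    by rewrite perm_sym; case: (perm3 y u x).
  apply: (@tripleI _ _ _ _ _ _ _ (d x y) Y (d u x) X) => //; try by apply: nesym.
  by rewrite dC.
case: (eqVneq (d u y) (d x y)) => [E|/eqP Ns].
  exists u, x, y, false, true, true; split=> //.
  by apply: (@tripleI _ _ _ _ _ _ _ (d x y) (d u x) X Y) => //; try by apply: nesym.
exists u, x, y, false, false, true; split=> //.
apply: (@tripleI _ _ _ _ _ _ _ (d x y) (d u x) X Y) => //; try by apply: nesym.
case: (boolP (own_edge U u y)) => [fy|]; first by rewrite -(Ny r rR fy) const.
case/not_own_edgeP=> p [q [pU qU pu qu [pq E]]]; exfalso.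
have aux z : z \in U -> z != u -> z != y -> d y z <> d u y.
  move=> zU zu zy; case: (eqVneq z x) => [->|zx]; first by rewrite dC; apply: nesym.
  by rewrite HY ?inE ?zy ?zx ?zu //; apply: nesym.
case: (eqVneq p y) => [e|py].
  by subst p; apply: (aux q) => //; rewrite eq_sym.
case: (eqVneq q y) => [e|qy]; first by subst q; apply: (aux p); rewrite // dC.
by have [] : d p q <> d u y by cneq.
Qed.

(** The own colour of [u] lies on an edge to the rest, and [const_star] spreads it over all of the
    rest. The triple is [y], [x], [u] with $S=\{yx,xu\}$. *)
Lemma triple_old U u x y t : u \in U -> dominating (U :\ u) x y -> full (U :\ u :\ x :\ y) ->
  t \in U :\ u :\ x :\ y -> own_edge U u t -> d u x = d x y -> d u y = d y t ->
  has_triple (U :\ u :\ x :\ y) u x y.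
Proof.
move=> uU D fR tR ft Ex Ey.
have R0 : U :\ u :\ x :\ y != set0 by apply/set0Pn; exists t.
have [X [Y [[xU yU xu yu xy] [n1 n2 n3] HX HY HR]]] := dominatingP D R0.
rewrite HY // in Ey; have [tU tu tx ty] := HR t tR.
have const : {in U :\ u :\ x :\ y, forall w, d u w = d u t}.
  apply: (const_star fR _ _ _ _ _ xy HX HY n1 Ex tR); rewrite ?inE ?eqxx ?andbF //; try vneq.
  move=> p q /HR[pU pu px py] /HR[qU qu qx qy] pq; cneq.
have k1 : d x y <> d u t by cneq.
have k2 : X <> d u t by rewrite -(HX t) //; cneq.
have k3 : Y <> d u t by rewrite -(HY t) //; cneq.
exists y, x, u, true, false, true; split.
  by case: (perm3 u x y).
by apply: (@tripleI _ _ _ _ _ _ _ (d x y) Y X (d u t)) => //; try (by apply: nesym); rewrite dC.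
Qed.

(** If [ux] is not own to [u], its colour recurs on an edge at [x] missing [u], so it is [X] or the
    colour of [xy]; similarly for [uy]. Colours [X] and [Y] mean domination, one of the two mixed
    choices is [triple_old], and both equal to [xy] is a monochromatic triangle. *)
Lemma even_step U u x y : u \in U -> dominating (U :\ u) x y -> full (U :\ u :\ x :\ y) ->
  U :\ u :\ x :\ y != set0 -> own U u != set0 ->
  dominating U x y \/ has_triple (U :\ u :\ x :\ y) u x y.
Proof.
move=> uU D fR R0 /set0Pn[k /(ownP _ uU)[t [tU tu _ ft]]].
have RC : U :\ u :\ y :\ x = U :\ u :\ x :\ y.
  by rewrite !setDDl (setUC [set y]).
have swap : has_triple (U :\ u :\ x :\ y) u y x -> has_triple (U :\ u :\ x :\ y) u x y.
  by apply: has_tripleC; case: (perm3 u x y).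
have D' := dominatingC D.
case: (boolP (own_edge U u x)) => [fx|nfx]; first by right; apply: triple_new.
case: (boolP (own_edge U u y)) => [fy|nfy].
  by right; apply: swap => //; rewrite -RC; apply: triple_new; rewrite ?RC.
have [X [Y [[xU yU xu yu xy] [n1 n2 n3] HX HY HR]]] := dominatingP D R0.
have tx : t != x by apply: contraNneq nfx => <-.
have ty : t != y by apply: contraNneq nfy => <-.
have tR : t \in U :\ u :\ x :\ y by rewrite !inE tx ty tu.
have aux a b (A : K) : ~~ own_edge U u a -> a \in U -> a != u -> [set a; b] = [set x; y] ->
    {in U :\ u :\ x :\ y, forall z, d a z = A} -> d u a = A \/ d u a = d a b.
  case/not_own_edgeP=> p [q [pU qU pu qu [pq E]]] aU au S H.
  have {}E : exists2 z, z \in U & [/\ z != u, z != a & d a z = d u a].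
    case: (eqVneq p a) => [e|pa]; first by subst p; exists q => //; split; rewrite // eq_sym.
    case: (eqVneq q a) => [e|qa]; first by subst q; exists p => //; split; rewrite // dC.
    by have [] : d p q <> d u a by cneq.
  have [z zU [zu za <-]] := E.
  case: (eqVneq z b) => [->|zb]; first by right.
  left; apply: H; have := in_set2 z a b; rewrite S (negPf za) (negPf zb) in_set2.
  by case/negbT/norP=> zx zy; rewrite !inE zx zy zu.
have oX := aux x y X nfx xU xu erefl HX.
have oY := aux y x Y nfy yU yu (setUC _ _) HY.
case: oX => EX; case: oY => EY.
- left; case: D => _ _ _ H1 H2; have In z : z \in U :\ x :\ y -> z = u \/ z \in U :\ u :\ x :\ y.
    by rewrite !inE; case: (eqVneq z u) => [|_ h]; [left | right; rewrite h].
  have Ex z : z \in U :\ x :\ y -> d x z = X by case/In=> [->|/HX //]; rewrite dC.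
  have Ey z : z \in U :\ x :\ y -> d y z = Y by case/In=> [->|/HY //]; rewrite dC.
  split=> // [z w zR wR|z zR]; first by split; rewrite ?(Ex z) ?(Ex w) ?(Ey z) ?(Ey w).
  by rewrite (Ex z) // (Ey z) // -(HX t tR) -(HY t tR); apply: H2.
- right; apply: swap => //; rewrite -RC; apply: (@triple_old _ _ _ _ t); rewrite ?RC //.
  by rewrite (HX t).
- by right; apply: (@triple_old _ _ _ _ t); rewrite ?(HY t).
- exfalso; apply: (@triangle_not_mono x y u) => //; rewrite 1?eq_sym // (dC y u) ?EY ?(dC x u) ?EX //.
Qed.

(** The copy without [ur] forces [uq] to repeat the colour of [up], [pq] or [qr]; the copy without
    [uq] forces [ur] to repeat that of [up], [pr] or [qr]. Of the nine combinations eight are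
    triples in a suitable order, and the ninth is a monochromatic triangle [uqr]. *)
Lemma triple_K4 u p q r : uniq [:: u; p; q; r] -> uniq [:: d p q; d p r; d q r] ->
  d u p <> d p q -> d u p <> d p r -> d u p <> d q r ->
  exists (x y z w : T) (b1 b2 b3 : bool),
    perm_eq [:: x; y; z; w] [:: u; p; q; r] /\ triple [set w] x y z b1 b2 b3.
Proof.
rewrite /= !inE !negb_or andbT -!andbA.
case/and5P=> up uq ur pq /andP[pr qr] /and3P[/eqP n1 /eqP n2 /andP[/eqP n3 _]] m1 m2 m3.
have pqc := dC q p; have prc := dC r p; have qrc := dC r q.
have upc := dC p u; have uqc := dC q u; have urc := dC r u.
have m4 : d u q <> d p r by cneq.
have m5 : d u r <> d p q by cneq.
have T4 x y z w (b1 b2 b3 : bool) s :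
    perm_eq [:: x; y; z; w] [:: u; p; q; r] -> 0 < b1 + b2 + b3 < 3 ->
    s <> d x w -> s <> d y w -> s <> d z w -> d x w <> d y w -> d x w <> d z w -> d y w <> d z w ->
    d x y = (if b1 then s else d x w) -> d x z = (if b2 then s else d x w) ->
    d y z = (if b3 then s else d y w) ->
    exists (x y z w : T) (b1 b2 b3 : bool),
    perm_eq [:: x; y; z; w] [:: u; p; q; r] /\ triple [set w] x y z b1 b2 b3.
  move=> pe b k1 k2 k3 k4 k5 k6 e1 e2 e3; exists x, y, z, w, b1, b2, b3; split=> //.
  by apply: (tripleI b k1 k2 k3 k4 k5 k6) => // w'; rewrite inE => /eqP->.
have oq : [\/ d u q = d u p, d u q = d p q | d u q = d q r].
  case: (eqVneq (d u q) (d u p)) => [|/eqP ?]; first by constructor 1.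
  case: (eqVneq (d u q) (d p q)) => [|/eqP ?]; first by constructor 2.
  case: (eqVneq (d u q) (d q r)) => [|/eqP ?]; first by constructor 3.
  by exfalso; rainbow u p q r.
have or : [\/ d u r = d u p, d u r = d p r | d u r = d q r].
  case: (eqVneq (d u r) (d u p)) => [|/eqP ?]; first by constructor 1.
  case: (eqVneq (d u r) (d p r)) => [|/eqP ?]; first by constructor 2.
  case: (eqVneq (d u r) (d q r)) => [|/eqP ?]; first by constructor 3.
  by exfalso; rainbow u p r q.
Ltac perm4 := apply/permP => ? /=; clear; lia.
case: oq => eq; case: or => er.
- by apply: (T4 u p q r false false true (d p q)); first [perm4 | by [] | congruence].
- by apply: (T4 u p r q false true true (d p r)); first [perm4 | by [] | congruence].
- by apply: (T4 u q r p false true true (d q r)); first [perm4 | by [] | congruence].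
- by apply: (T4 u p q r false true true (d p q)); first [perm4 | by [] | congruence].
- by apply: (T4 q r p u true false false (d q r)); first [perm4 | by [] | congruence].
- by apply: (T4 q u r p false true true (d q r)); first [perm4 | by [] | congruence].
- by apply: (T4 u r q p false true true (d q r)); first [perm4 | by [] | congruence].
- by apply: (T4 r u q p false true true (d q r)); first [perm4 | by [] | congruence].
- by exfalso; apply: (@triangle_not_mono u q r) => //; congruence.
Qed.

(** * Extremal lists *)

(** Only equalities between colours are compared, which builds in the renaming of colours. *)
Definition pattern x0 p S (l : seq T) : Prop :=
  forall i j i' j', i < j < size l -> i' < j' < size l ->
  (d (nth x0 l i) (nth x0 l j) == d (nth x0 l i') (nth x0 l j')) =
  (key p S i j == key p S i' j').

(** This prepends one block [t], a pair or a triple: [s] is the colour of its single component of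
    $J$, and [gs] lists the colours of the other edges by their first vertex. These colours are new
    to [l], so no equality links block and tail, while [shift_key] preserves the equalities inside
    the tail. *)
Lemma pattern_cat x0 (t l : seq T) p S p' S' s (gs : seq K) :
  uniq l -> uniq (s :: gs) -> size gs = size t ->
  {in s :: gs, forall k, k \notin cols [set w in l]} ->
  (forall i j, i < size t -> i < j < size (t ++ l) ->
     let c := d (nth x0 (t ++ l) i) (nth x0 (t ++ l) j) in
     (key p S i j = inr 0 /\ c = s) \/ (key p S i j = inl i /\ c = nth s gs i)) ->
  (forall i j, i < j < size l ->
     key p S (size t + i) (size t + j) = shift_key (size t) (key p' S' i j)) ->
  pattern x0 p' S' l -> pattern x0 p S (t ++ l).
Proof.
move=> ul us st new blk sh pat.
have late i j : size t <= i -> i < j < size (t ++ l) ->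
    exists i1 j1, [/\ i = size t + i1, j = size t + j1 & i1 < j1 < size l].
  rewrite size_cat => ti /andP[ij jn]; exists (i - size t), (j - size t); split; lia.
have nthl i : nth x0 (t ++ l) (size t + i) = nth x0 l i.
  by rewrite nth_cat ltnNge leq_addr /= addKn.
have cross i j i' j' : i < size t -> i < j < size (t ++ l) ->
    size t <= i' -> i' < j' < size (t ++ l) ->
    (d (nth x0 (t ++ l) i) (nth x0 (t ++ l) j) ==
     d (nth x0 (t ++ l) i') (nth x0 (t ++ l) j')) = (key p S i j == key p S i' j').
  move=> it ij ti' /(late _ _ ti')[i1 [j1 [-> -> /andP[ij1 jl]]]].
  rewrite !nthl sh ?ij1 //.
  have inl' : d (nth x0 l i1) (nth x0 l j1) \in cols [set w in l].
    apply: colsI; rewrite ?inE ?mem_nth ?(ltn_trans ij1) //.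
    by rewrite nth_uniq ?(ltn_trans ij1) // neq_ltn ij1.
  have nc c : c \in s :: gs -> (c == d (nth x0 l i1) (nth x0 l j1)) = false.
    by move/new=> nc; apply: contraNF nc => /eqP->.
  case: (blk i j it ij) => -[-> ->]; rewrite nc ?mem_head //.
  - by case: (key p' S' i1 j1) => m /=; symmetry; apply/eqP => // -[]; lia.
  - by case: (key p' S' i1 j1) => m /=; symmetry; apply/eqP => // -[]; lia.
  - by rewrite in_cons mem_nth ?orbT // st.
move=> i j i' j' ij ij'.
case: (ltnP i (size t)) => it; case: (ltnP i' (size t)) => it'; last first.
- have [a [b [-> -> ab]]] := late i j it ij; have [a' [b' [-> -> ab']]] := late i' j' it' ij'.
  by rewrite !nthl !sh // (inj_eq (@shift_key_inj _)); apply: pat.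
- by rewrite eq_sym cross // eq_sym.
- exact: cross.
case/andP: us => sg ug; have sn k : k < size t -> (s == nth s gs k) = false.
  by move=> kt; apply: contraNF sg => /eqP {1}->; rewrite mem_nth ?st.
case: (blk i j it ij) => -[-> ->]; case: (blk i' j' it' ij') => -[-> ->].
- by rewrite !eqxx.
- by rewrite sn.
- by rewrite eq_sym sn.
- by rewrite nth_uniq ?st.
Qed.

Lemma pattern_pair x0 U x y l p S : dominating U x y -> uniq l -> l =i U :\ x :\ y ->
  l != [::] -> pattern x0 p S l -> pattern x0 p.+2 S (x :: y :: l).
Proof.
case=> xU yU xy H1 H2 ul El l0.
have Er : [set w in l] = U :\ x :\ y by apply/setP => w; rewrite inE El.
have [r rl] : exists r, r \in l by case: (l) l0 => // r m _; exists r; rewrite mem_head.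
have rR : r \in U :\ x :\ y by rewrite -El.
apply: (@pattern_cat x0 [:: x; y] l _ _ p S (d x y) [:: d x r; d y r]) => //.
- exact: H2.
(* An edge of the rest is disjoint from [xy]; if it had the constant colour at [x] or at [y], it
   would close a monochromatic triangle. *)
- move=> k; rewrite Er => kin; apply/negP => /colsP[a [b [aR bR ab E]]].
  have [aU ax ay] := dominating_rest aR; have [bU bx by_] := dominating_rest bR.
  move: kin E; rewrite !inE => /or3P[]/eqP->.
  + by move=> F; have [] : d a b <> d x y by cneq.
  + by have [E _] := H1 a r aR rR; have [E' _] := H1 b r bR rR => F;
      apply: (@triangle_not_mono x a b); [vneq|vneq|vneq|congruence|congruence].
  + by have [_ E] := H1 a r aR rR; have [_ E'] := H1 b r bR rR => F;
      apply: (@triangle_not_mono y a b); [vneq|vneq|vneq|congruence|congruence].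
- have Ln j : j < size l -> nth x0 l j \in U :\ x :\ y by move=> jl; rewrite -El mem_nth.
  have K1 j : key p.+2 S 0 j.+2 = inl 0 by rewrite /key /joined (lead_pair p j).
  have K2 j : key p.+2 S 1 j.+2 = inl 1 by rewrite /key /joined (lead_pair p j).
  move=> [|[|i]] [|[|j]] //= _; rewrite ?ltnS => jl.
  + by left.
  + by right; split=> //; case: (H1 _ r (Ln j jl) rR).
  + by right; split=> //; case: (H1 _ r (Ln j jl) rR).
- by move=> i j _; rewrite key_pair.
Qed.

Lemma pattern_triple x0 x y z l (b1 b2 b3 : bool) p S : triple [set w in l] x y z b1 b2 b3 ->
  uniq [:: x, y, z & l] -> size l <= p -> pattern x0 p S l ->
  pattern x0 0 (sel b1 b2 b3) [:: x, y, z & l].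
Proof.
case=> b [s [g1 [g2 [g3 [us H e1 e2 e3]]]]] /= /and4P[].
rewrite !inE !negb_or => /and3P[xy xz xl] /andP[yz yl] zl ul lp.
have out v w : v \notin l -> w \in l -> w != v.
  by move=> vl wl; apply: contraNneq vl => <-.
apply: (@pattern_cat x0 [:: x; y; z] l _ _ p S s [:: g1; g2; g3]) => //.
- move=> k kin; apply/negP => /colsP[a [c [aR cR ac E]]].
  have [a1 a2 a3] := H a aR; have [c1 c2 c3] := H c cR.
  rewrite !inE in aR cR.
  have [ax ay az] : [/\ a != x, a != y & a != z] by split; apply: out.
  have [cx cy cz] : [/\ c != x, c != y & c != z] by split; apply: out.
  move: kin E; rewrite !inE => /or4P[]/eqP->.
  (* At least one edge of the triple has colour [s], and it is disjoint from [ac]. *)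
  + case: b1 b2 b3 b e1 e2 e3 => [] [] [] //= _ e1 e2 e3 E; first
      [ by have [] : d a c <> d x y; [cneq | congruence]
      | by have [] : d a c <> d x z; [cneq | congruence]
      | by have [] : d a c <> d y z; [cneq | congruence] ].
  + by move=> F; apply: (@triangle_not_mono x a c); [vneq|vneq|vneq|congruence|congruence].
  + by move=> F; apply: (@triangle_not_mono y a c); [vneq|vneq|vneq|congruence|congruence].
  + by move=> F; apply: (@triangle_not_mono z a c); [vneq|vneq|vneq|congruence|congruence].
- have Ln j : j < size l -> nth x0 l j \in [set w in l] by move=> jl; rewrite inE mem_nth.
  have K1 j : key 0 (sel b1 b2 b3) 0 j.+3 = inl 0 by [].
  have K2 j : key 0 (sel b1 b2 b3) 1 j.+3 = inl 1 by [].
  have K3 j : key 0 (sel b1 b2 b3) 2 j.+3 = inl 2 by [].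
  move=> [|[|[|i]]] [|[|[|j]]] //= _; rewrite ?ltnS => jl.
  + by rewrite e1 /key /=; case: (b1); [left | right].
  + by rewrite e2 /key /=; case: (b2); [left | right].
  + by right; split=> //; case: (H _ (Ln j jl)).
  + by rewrite e3 /key /=; case: (b3); [left | right].
  + by right; split=> //; case: (H _ (Ln j jl)).
  + by right; split=> //; case: (H _ (Ln j jl)).
- by move=> i j ij; rewrite (@key_triple p _ S (size l)).
Qed.

(** Dominating pairs are peeled off until one vertex is left. The condition [size l <= p] puts the
    triple beyond the end of the list, so there are pairs only. *)
Lemma full_pattern U : #|U| = 1 \/ (full U /\ U != set0) ->
  exists l : seq T, [/\ uniq l, l =i U &
    forall x0 p S, size l <= p -> pattern x0 p S l].
Proof.
have [n] := ubnP #|U|; elim: n U => // n IHn U Un [/eqP/cards1P[z ->]|[fU U0]].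
  exists [:: z]; split=> // [w|x0 p S _ [|i] [|j] i' j' /=]; rewrite ?inE ?ltnS ?ltn0 ?andbF //.
have [x [y D]] := full_dominating fU U0; have [R0 o] := full_rest fU D.
have [xU yU xy _ _] := D.
have [||l [ul El pat]] := IHn (U :\ x :\ y).
- by move: Un; rewrite (card_rest xU yU xy) => /ltnW.
- by case: o; [left | right].
have l0 : l != [::].
  by have [r rR] := set0Pn _ R0; move: rR; rewrite -El; case: (l).
exists [:: x, y & l]; split=> [|w|x0 p S lp].
- by rewrite /= !inE !El !inE !eqxx /= !andbF orbF xy.
- rewrite !inE El !inE; case: (eqVneq w x) => [->|_]; first by rewrite xU.
  by case: (eqVneq w y) => [->|_]; rewrite ?yU.
case: p lp => [|[|p]] // lp; apply: (@pattern_pair x0 _ _ _ l p S D) => //; exact: pat.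
Qed.

(** Four vertices are the case of [triple_K4]. Otherwise [even_step] gives either a triple followed
    by the pairs of [full_pattern], or a pair dominating all of [U]; peeling that pair off moves the
    triple by two, so [p] stays even. *)
Lemma even_pattern U u : u \in U -> full (U :\ u) -> own U u != set0 ->
  exists (l : seq T) p (b1 b2 b3 : bool), [/\ uniq l, l =i U,
    ~~ odd p /\ p + 3 <= size l, 0 < b1 + b2 + b3 < 3 &
    forall x0, pattern x0 p (sel b1 b2 b3) l].
Proof.
have [n] := ubnP #|U|; elim: n U => // n IHn U Un uU fU' oU.
have U'0 : U :\ u != set0.
  by have [k /(ownP _ uU)[t [tU tu _ _]]] := set0Pn _ oU; apply/set0Pn; exists t; rewrite !inE tu.
have [x [y D]] := full_dominating fU' U'0; have [R0 o] := full_rest fU' D.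
have [X [Y [[xU yU xu yu xy] [n1 n2 n3] HX HY HR]]] := dominatingP D R0.
have inU w : (w \in U) = [|| w == u, w == x, w == y | w \in U :\ u :\ x :\ y].
  rewrite !inE; case: (eqVneq w u) => [->|_]; first by rewrite uU.
  case: (eqVneq w x) => [->|_]; first by rewrite xU.
  by case: (eqVneq w y) => [->|_]; rewrite ?yU.
case: o => [/eqP/cards1P[r Er]|fR].
  have rR : r \in U :\ u :\ x :\ y by rewrite Er inE.
  have [rU ru rx ry] := HR r rR.
  have u4 : uniq [:: u; x; y; r].
    by rewrite /= !inE !negb_or; do ?[apply/andP; split]; first [vneq | by []].
  have u3 : uniq [:: d x y; d x r; d y r] by case: D => _ _ _ _; apply.
  have /uniq3P[k1 k2 k3] := u3.
  (* The vertex [p] is the other end of an edge carrying an own colour of [u]. *)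
  have [p [q [z [pq u3' [m1 m2 m3]]]]] : exists p q z, [/\ perm_eq [:: u; p; q; z] [:: u; x; y; r],
      uniq [:: d p q; d p z; d q z] & [/\ d u p <> d p q, d u p <> d p z & d u p <> d q z]].
    have [k /(ownP _ uU)[t [tU tu _ ft]]] := set0Pn _ oU.
    have yx := dC y x; have rx' := dC r x; have ry' := dC r y.
    move: tU; rewrite inU (negPf tu) /= Er inE => /or3P[]/eqP e; subst t.
    - by exists x, y, r; split=> //; split; cneq.
    - exists y, x, r; split; [by apply/permP => ? /=; clear; lia | | split; cneq].
      by rewrite /= !inE negb_or andbT -andbA; apply/and3P; split; apply/eqP; congruence.
    - exists r, x, y; split; [by apply/permP => ? /=; clear; lia | | split; cneq].
      by rewrite /= !inE negb_or andbT -andbA; apply/and3P; split; apply/eqP; congruence.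
  have u4' : uniq [:: u; p; q; z] by rewrite (perm_uniq pq).
  have [a [b [c [w [b1 [b2 [b3 [pe tr]]]]]]]] := triple_K4 u4' u3' m1 m2 m3.
  exists [:: a; b; c; w], 0, b1, b2, b3; split=> //.
  - by rewrite (perm_uniq pe).
  - by move=> v; rewrite (perm_mem pe) (perm_mem pq) inU Er !inE.
  - by case: tr.
  (* The tail is a single vertex without edges, so its pattern is vacuous for the choice [1] and
     constant [true]. *)
  - move=> x0; apply: (@pattern_triple x0 a b c [:: w] b1 b2 b3 1 (fun _ _ => true)) => //.
    + by rewrite (_ : [set v in [:: w]] = [set w]) //; apply/setP => v; rewrite !inE.
    + by rewrite (perm_uniq pe).
    + by move=> [|i] [|j] i' j' /=; rewrite ?ltnS ?ltn0 ?andbF.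
have [l [ul El pat]] := full_pattern (or_intror (conj fR R0)).
have ls : [set w in l] = U :\ u :\ x :\ y by apply/setP => w; rewrite inE El.
case: (even_step uU D fR R0 oU) => [D'|[a [b [c [b1 [b2 [b3 [pe tr]]]]]]]]; last first.
  have u3 : uniq [:: a; b; c].
    by rewrite (perm_uniq pe) /= !inE negb_or !(eq_sym u) xu yu xy.
  have ul' : uniq [:: a, b, c & l].
    rewrite -[a :: _]/([:: a; b; c] ++ l) cat_uniq u3 ul andbT /=.
    apply/hasPn => v; rewrite El => /HR[_ v1 v2 v3].
    by rewrite (perm_mem pe) !inE !negb_or v1 v2 v3.
  exists [:: a, b, c & l], 0, b1, b2, b3; split=> //.
  - move=> v; rewrite -[a :: _]/([:: a; b; c] ++ l) mem_cat (perm_mem pe) El inU !inE.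
    by rewrite -!orbA.
  - by case: tr.
  - move=> x0; apply: (@pattern_triple x0 a b c l b1 b2 b3 (size l) (fun _ _ => true)) => //.
    + by rewrite ls.
    + exact: pat.
have [r rR] := set0Pn _ R0; have [rU ru rx ry] := HR r rR.
have sR : U :\ x :\ y :\ u = U :\ u :\ x :\ y.
  by apply/setP => w; rewrite !inE; do 3 case: (w == _).
have uU' : u \in U :\ x :\ y by rewrite !inE uU !(eq_sym u) xu yu.
have rU' : r \in U :\ x :\ y by rewrite !inE rU rx ry.
have [||||l' [p [b1 [b2 [b3 [ul' El' [op ps] bb pat']]]]]] := IHn (U :\ x :\ y).
- by move: Un; rewrite (card_rest xU yU xy) => /ltnW.
- by [].
- by rewrite sR.
(* An own edge of [u] does not go to [x] or [y]: its colour would recur at [r]. Hence it survives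
   the removal of the pair. *)
- have [k /(ownP _ uU)[t [tU tu Et ft]]] := set0Pn _ oU.
  have [_ _ _ H1 _] := D'; have [E1 E2] := H1 _ _ uU' rU'.
  apply/set0Pn; exists k; apply/(ownP _ uU'); exists t; split=> //.
    rewrite !inE tU andbT; apply/andP; split; apply/eqP => e; subst t.
      by have [] : d y r <> d u y; [cneq | rewrite -E2 dC].
    by have [] : d x r <> d u x; [cneq | rewrite -E1 dC].
  by apply: own_edgeS ft; rewrite setDDl subDset subsetUr.
exists [:: x, y & l'], p.+2, b1, b2, b3; split=> //.
- by rewrite /= !inE !El' !inE !eqxx /= !andbF orbF xy.
- move=> w; rewrite !inE El' !inE; case: (eqVneq w x) => [->|_]; first by rewrite xU.
  by case: (eqVneq w y) => [->|_]; rewrite ?yU.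
- by rewrite /= negbK.
- move=> x0; apply: (@pattern_pair x0 _ _ _ l' p _ D') => //.
  by case: (l') ps => //; rewrite addn3.
Qed.

End LocalColouring.

(** * Graphs and edge-colourings *)

Lemma pairs2 (T : finType) (x y : T) : ([set x; y] \in pairs [set: T]) = (x != y).
Proof. by rewrite inE subsetT cards2; case: (x != y). Qed.

Lemma pairsP (T : finType) (e : {set T}) :
  reflect (exists x y, x != y /\ e = [set x; y]) (e \in pairs [set: T]).
Proof.
apply: (iffP idP) => [|[x [y [xy ->]]]]; last by rewrite pairs2.
by rewrite inE => /andP[_ /cards2P[x [y [xy ->]]]]; exists x, y.
Qed.

Section Classes.

Variables (n : nat) (C : eqType) (c : {set complete_graph n} -> C).

(* Colours are replaced by their classes, which live in a finite type. *)
Definition class (e : {set 'I_n}) : {set {set 'I_n}} :=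
  colour_class (G := complete_graph n) c (c e).

Definition edge_class (x y : 'I_n) := class [set x; y].

Lemma mem_class e e' : (e' \in class e) = (e' \in pairs [set: 'I_n]) && (c e' == c e).
Proof. by rewrite /class /colour_class [LHS]in_set. Qed.

Lemma classE : {in pairs [set: 'I_n] &, forall e e', (class e == class e') = (c e == c e')}.
Proof.
move=> e e' eP eP'; apply/eqP/eqP => [|E]; last by rewrite /class E.
by move/setP/(_ e); rewrite !mem_class eP eqxx => /esym/eqP.
Qed.

Lemma edge_classE x y z w : x != y -> z != w ->
  (edge_class x y == edge_class z w) = (c [set x; y] == c [set z; w]).
Proof. by move=> xy zw; rewrite /edge_class classE ?pairs2. Qed.

Lemma mem_colours e : e \in pairs [set: 'I_n] -> c e \in colours (G := complete_graph n) c.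
Proof. by move=> eP; rewrite mem_undup; apply/imageP; exists e. Qed.

Lemma colour_centre x y : star_colouring (G := complete_graph n) c -> x != y ->
  exists v, forall z w, z != w -> edge_class z w = edge_class x y -> v \in [set z; w].
Proof.
move=> st xy; have xyP : [set x; y] \in pairs [set: 'I_n] by rewrite pairs2.
have [v [L [_ _ E]]] := st _ (mem_colours xyP).
exists v => z w zw /eqP; rewrite edge_classE // => /eqP Ec.
have : [set z; w] \in colour_class (G := complete_graph n) c (c [set x; y]).
  by rewrite -/(class [set x; y]) mem_class pairs2 zw Ec eqxx.
by rewrite E => /imsetP[u _ ->]; rewrite !inE eqxx.
Qed.

Lemma star_local : star_colouring (G := complete_graph n) c -> local_star edge_class.
Proof.
move=> st; split.
- by move=> x y; rewrite /edge_class setUC.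
- move=> x y z w xy zw E; have [v H] := colour_centre st xy.
  have := H x y xy erefl; have := H z w zw (esym E); rewrite !inE.
  by case/orP=> /eqP-> /orP[]/eqP->; rewrite eqxx ?orbT.
- move=> x y z xy yz xz E1 E2; have [v H] := colour_centre st yz.
  have := H x y xy E1; have := H x z xz E2; have := H y z yz erefl; rewrite !inE.
  case: (eqVneq v x) => [->|_] /=; first by rewrite (negPf xy) (negPf xz).
  by case: (eqVneq v y) => [->|_] //=; rewrite (negPf yz).
Qed.

(** The list follows the order of the colours in [no_rainbow], which turns injectivity on edges into
    [uniq] of a list. *)
Lemma K4minus_edge (e : {set 'I_4}) : e \in edges K4minus ->
  exists m : 'I_5, e = nth set0 [:: [set inord 0; inord 1]; [set inord 0; inord 2];
    [set inord 1; inord 2]; [set inord 1; inord 3]; [set inord 2; inord 3]] m.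
Proof.
rewrite in_setD1 => /andP[n03 /pairsP[i [j [ij E]]]]; subst e.
wlog ltij : i j ij n03 / i < j.
  move=> W; case: (ltngtP i j) => [||/val_inj e]; [exact: W | | by rewrite e eqxx in ij].
  by move=> ltji; rewrite setUC; apply: W => //; [rewrite eq_sym | rewrite setUC].
have io (k : 'I_4) : k = inord k by apply: val_inj; rewrite /= inordK.
have n03' : ~~ ((i == 0 :> nat) && (j == 3 :> nat)).
  apply: contra n03 => /andP[/eqP i0 /eqP j3]; apply/eqP; congr [set _; _]; exact: val_inj.
have [m [m5 Em]] : exists m, m < 5 /\ [set i; j] =
    nth set0 [:: [set inord 0; inord 1]; [set inord 0; inord 2];
    [set inord 1; inord 2]; [set inord 1; inord 3]; [set inord 2; inord 3]] m.
  move: ltij n03' (ltn_ord i) (ltn_ord j); rewrite (io i) (io j) !inordK //.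
  case: (nat_of_ord i) => [|[|[|[|i']]]]; case: (nat_of_ord j) => [|[|[|[|j']]]] // _ _ _ _.
  - by exists 0.
  - by exists 1.
  - by exists 2.
  - by exists 3.
  - by exists 4.
by exists (Ordinal m5).
Qed.

Lemma no_rainbow_local : ~ has_rainbow_copy K4minus (G := complete_graph n) c ->
  no_rainbow edge_class.
Proof.
move=> nr x y z w u4; apply/negP => u5; apply: nr.
pose f (i : 'I_4) : 'I_n := nth x [:: x; y; z; w] i.
have finj : injective f.
  by move=> i j /eqP; rewrite nth_uniq // => /eqP /val_inj.
have fE i j : f @: [set i; j] = [set f i; f j] by rewrite imsetU1 imset_set1.
have cl (m : 'I_5) : class (f @: nth set0 [:: [set inord 0; inord 1]; [set inord 0; inord 2];
    [set inord 1; inord 2]; [set inord 1; inord 3]; [set inord 2; inord 3]] m) =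
    nth set0 [:: edge_class x y; edge_class x z; edge_class y z; edge_class y w; edge_class z w] m.
  by case: m => -[|[|[|[|[|m]]]]] //= _; rewrite fE /f !inordK.
have fedge (e : {set 'I_4}) : e \in edges K4minus -> f @: e \in pairs [set: 'I_n].
  rewrite in_setD1 => /andP[_ /pairsP[i [j [ij ->]]]].
  by rewrite fE pairs2 (inj_eq finj).
exists f; split=> // e e' eE eE' /eqP; rewrite -classE ?fedge //.
have [m ->] := K4minus_edge eE; have [m' ->] := K4minus_edge eE'.
by rewrite !cl nth_uniq // => /eqP ->.
Qed.

Lemma size_colours : size (colours (G := complete_graph n) c) = #|cols edge_class [set: 'I_n]|.
Proof.
have E : cols edge_class [set: 'I_n] =i undup [seq class e | e <- enum (pairs [set: 'I_n])].
  move=> k; rewrite mem_undup; apply/colsP/mapP => [[x [y [_ _ xy <-]]]|[e]].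
    by exists [set x; y]; rewrite // mem_enum pairs2.
  by rewrite mem_enum => /pairsP[x [y [xy ->]]] ->; exists x, y.
rewrite (eq_card E) (card_uniqP (undup_uniq _)) /colours /image_mem /=.
have : {in enum (pairs [set: 'I_n]), forall e, e \in pairs [set: 'I_n]} by move=> e; rewrite mem_enum.
elim: (enum _) => //= e s IH h.
have hs : {in s, forall e, e \in pairs [set: 'I_n]} by move=> e' es; apply: h; rewrite inE es orbT.
have -> : (c e \in [seq c e0 | e0 <- s]) = (class e \in [seq class e0 | e0 <- s]).
  have eP := h e (mem_head e s).
  by apply/mapP/mapP => -[e' es /eqP E']; exists e' => //; apply/eqP; move: E';
    rewrite classE // hs.
by case: ifP => _ /=; rewrite (IH hs).
Qed.

End Classes.

(** * The ordering given by a list, and the components of $J$ *)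

Section Ordering.

Variables (n : nat) (x0 : 'I_n) (l : seq 'I_n).
Hypotheses (ul : uniq l) (sl : size l = n).

(** The ordering starts at $v_1$ and the list at position 0. *)
Definition order_of i := nth x0 l i.-1.

Lemma mem_order x : x \in l.
Proof.
have E : #|l| = #|'I_n| by rewrite (card_uniqP ul) sl card_ord.
by have /(subset_cardP E) -> := subset_predT (mem l).
Qed.

Lemma index_lt x : index x l < n.
Proof. by have := mem_order x; rewrite -index_mem => /leq_trans; apply; rewrite sl. Qed.

Lemma order_of_ordering : is_ordering order_of.
Proof.
move=> i j; rewrite !inE => ni nj /eqP; rewrite /order_of nth_uniq ?sl //; lia.
Qed.

Lemma edge_order (e : {set 'I_n}) : e \in pairs [set: 'I_n] ->
  exists i j, i < j < n /\ e = [set nth x0 l i; nth x0 l j].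
Proof.
case/pairsP=> x [y [xy ->]]; have xl := mem_order x; have yl := mem_order y.
have : index x l != index y l by apply: contraNneq xy => /(@index_inj _ x0 l x y xl yl)->.
rewrite neq_ltn => /orP[ij|ij]; [exists (index x l), (index y l) | exists (index y l), (index x l)].
  by rewrite ij index_lt !nth_index.
by rewrite ij index_lt !nth_index // setUC.
Qed.

Lemma min_order i j : i < j < n ->
  min_colouring order_of [set nth x0 l i; nth x0 l j] = i.+1.
Proof.
case/andP=> ij jn; rewrite /min_colouring.
have ilt : i < n by apply: ltn_trans jn.
apply/eqP; rewrite eqn_leq; apply/andP; split.
  have := mem_index_iota 1 n.+1 i.+1; rewrite /= ltnS ilt.
  elim: (index_iota 1 n.+1) => // k s IH; rewrite inE big_cons => /orP[/eqP<-|/IH h].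
    by rewrite /order_of /= !inE eqxx /= geq_minl.
  by case: ifP => // _; apply: leq_trans (geq_minr _ _) h.
rewrite big_nat_cond; apply: (big_ind (fun m => i < m)) => // [a b ia ib|k].
  by rewrite leq_min ia ib.
case/andP=> k1; rewrite !inE /order_of !nth_uniq ?sl //; lia.
Qed.

Variables (p : nat) (S : nat -> nat -> bool) (J : {set {set 'I_n}}).
Hypotheses (sJ : J \subset pairs [set: 'I_n])
  (HJ : forall i j, i < j < n -> ([set nth x0 l i; nth x0 l j] \in J) = joined p S i j).

Lemma component_connect e x : e \in J -> x \in e ->
  component J e = [set y | connect (fun x y => [set x; y] \in J) x y].
Proof.
move=> eJ xe; apply/setP => y; rewrite !inE; apply/exists_inP/idP => [[z ze czy]|cxy]; last by exists x.
apply: connect_trans czy; case: (eqVneq x z) => [->|xz]; first exact: connect0.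
have /pairsP[a [b [ab E]]] := subsetP sJ e eJ.
apply: connect1; suff -> : [set x; z] = e by [].
move: xe ze xz; rewrite E !inE => /orP[]/eqP-> /orP[]/eqP->; rewrite ?eqxx //.
by rewrite setUC.
Qed.

Lemma component_share e e' x : e \in J -> e' \in J -> x \in e -> x \in e' ->
  component J e = component J e'.
Proof. by move=> eJ e'J xe xe'; rewrite (component_connect eJ xe) (component_connect e'J xe'). Qed.

(** Each edge of $J$ joins vertices with equal [lead], so [lead] is constant on components. *)
Lemma lead_component e e' x x' : e \in J -> e' \in J -> x \in e -> x' \in e' ->
  component J e = component J e' -> lead p (index x l) = lead p (index x' l).
Proof.
move=> eJ e'J xe xe' E.
have : x \in component J e by rewrite (component_connect eJ xe) inE connect0.
rewrite E (component_connect e'J xe') inE => /closed_connect c.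
have := c [pred z | lead p (index z l) == lead p (index x' l)].
rewrite !inE eqxx => {}c; apply/eqP/esym; apply: c => z w zwJ; rewrite !inE.
have : [set z; w] \in pairs [set: 'I_n] by apply: (subsetP sJ).
rewrite pairs2 => zw; suff -> : lead p (index z l) = lead p (index w l) by [].
wlog zlw : z w zw zwJ / index z l < index w l.
  move=> W; case: (ltngtP (index z l) (index w l)) => [||/(@index_inj _ x0 l z w (mem_order z) (mem_order w)) e0].
  - exact: W.
  - by move=> h; apply/esym/W; rewrite // 1?eq_sym // setUC.
  - by rewrite e0 eqxx in zw.
have := @HJ (index z l) (index w l); rewrite !nth_index ?mem_order // zwJ zlw index_lt.
by move=> /(_ isT) /esym /andP[/eqP].
Qed.

Lemma lead_bounds k : ~~ odd p -> lead p k <= k <= lead p k + 1 + (lead p k == p).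
Proof.
rewrite /lead => op; case: (ltnP k p) => h1; last case: (ltnP k p.+3) => h2; lia.
Qed.

(** Vertices with the same [lead] form a pair or the triple, and any two edges inside at most three
    vertices meet. Hence equal [lead] gives equal components. *)
Lemma joined_share i j i' j' : i < j -> i' < j' -> ~~ odd p ->
  joined p S i j -> joined p S i' j' -> lead p i = lead p i' ->
  [|| i == i', i == j', j == i' | j == j'].
Proof.
move=> ij ij' op /andP[/eqP h _] /andP[/eqP h' _] hh.
have := lead_bounds i op; have := lead_bounds j op.
have := lead_bounds i' op; have := lead_bounds j' op.
rewrite -h -h' -hh; lia.
Qed.

Lemma recolour_key i j i' j' : ~~ odd p -> i < j < n -> i' < j' < n ->
  let r := recolour (min_colouring order_of) J in
  (r [set nth x0 l i; nth x0 l j] == r [set nth x0 l i'; nth x0 l j']) =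
  (key p S i j == key p S i' j').
Proof.
move=> op ij ij'; rewrite /= /recolour /key !HJ //.
case: ifP => c; case: ifP => c' //; last by rewrite !min_order.
have eJ : [set nth x0 l i; nth x0 l j] \in J by rewrite HJ.
have e'J : [set nth x0 l i'; nth x0 l j'] \in J by rewrite HJ.
have /andP[ij1 jn] := ij; have /andP[ij1' jn'] := ij'.
apply/eqP/eqP => -[E]; congr inr.
  have := lead_component eJ e'J (set21 _ _) (set21 _ _) E.
  by rewrite !index_uniq ?sl // ?(ltn_trans ij1) ?(ltn_trans ij1').
case/or4P: (joined_share ij1 ij1' op c c' E) => /eqP e.
- by apply: (component_share (x := nth x0 l i) eJ e'J); rewrite !inE -?e eqxx ?orbT.
- by apply: (component_share (x := nth x0 l i) eJ e'J); rewrite !inE -?e eqxx ?orbT.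
- by apply: (component_share (x := nth x0 l j) eJ e'J); rewrite !inE -?e eqxx ?orbT.
- by apply: (component_share (x := nth x0 l j) eJ e'J); rewrite !inE -?e eqxx ?orbT.
Qed.

End Ordering.

(** * From patterns to the extremal structure *)

Lemma same_up_to_renaming_kernel (G : sgraph) (C C' : eqType)
    (c : {set G} -> C) (c' : {set G} -> C') :
  {in edges G &, forall e e', (c e == c e') = (c' e == c' e')} -> same_up_to_renaming c c'.
Proof.
move=> H.
(* A colour of [c'] is sent to the colour under [c] of any edge carrying it; [c set0] is a default
   for values that no edge has. *)
exists (fun k => if [pick e in edges G | c' e == k] is Some e then c e else c set0).
  move=> k k'; rewrite !mem_undup => /imageP[e eG ->] /imageP[e' eG' ->].
  case: pickP => [a /andP[aG /eqP Ea]|/(_ e)]; last by rewrite eG eqxx.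
  case: pickP => [b /andP[bG /eqP Eb]|/(_ e')]; last by rewrite eG' eqxx.
  by move/eqP; rewrite H // Ea Eb => /eqP.
move=> e eG; case: pickP => [a /andP[aG Ea]|/(_ e)]; last by rewrite eG eqxx.
by apply/eqP; rewrite H // eq_sym.
Qed.

Lemma extremal_from_pattern n (C : eqType) (c : {set complete_graph n} -> C)
    (x0 : 'I_n) (l : seq 'I_n) p S (J : {set {set 'I_n}}) :
  uniq l -> size l = n -> ~~ odd p -> J \subset pairs [set: 'I_n] ->
  (forall i j, i < j < n -> ([set nth x0 l i; nth x0 l j] \in J) = joined p S i j) ->
  pattern (edge_class c) x0 p S l -> extremal_graph (order_of x0 l) J ->
  has_extremal_structure c.
Proof.
move=> ul sl op sJ HJ pat ext; exists (order_of x0 l), J; split=> //.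
  exact: order_of_ordering.
apply: same_up_to_renaming_kernel => e e' /(edge_order x0 ul sl)[i [j [ij ->]]].
case/(edge_order x0 ul sl)=> i' [j' [ij' ->]].
have neq a b : a < b < n -> nth x0 l a != nth x0 l b.
  by move=> ab; rewrite nth_uniq ?sl //; lia.
by rewrite -edge_classE ?neq // pat ?sl // (recolour_key ul sl sJ HJ).
Qed.

Lemma mem_bigcup_seq (T : finType) (r : seq nat) (F : nat -> {set T}) x :
  (x \in \bigcup_(k <- r) F k) = has (fun k => x \in F k) r.
Proof. by elim: r => [|k r IH]; rewrite ?big_nil ?big_cons !inE // IH. Qed.

Lemma eq_set2_nth (T : finType) (x0 : T) (l : seq T) i j a b :
  uniq l -> i < j < size l -> a < b < size l ->
  ([set nth x0 l i; nth x0 l j] == [set nth x0 l a; nth x0 l b]) = (i == a) && (j == b).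
Proof.
move=> ul ij ab; apply/eqP/andP => [/setP E|[/eqP-> /eqP->] //].
have Ei := E (nth x0 l i); have Ej := E (nth x0 l j).
rewrite !inE !nth_uniq ?eqxx /= in Ei Ej; lia.
Qed.

Lemma odd_extremal n m (C : eqType) (c : {set complete_graph n} -> C) (x0 : 'I_n) (l : seq 'I_n) :
  n = 2 * m + 1 -> uniq l -> size l = n ->
  (forall p S, size l <= p -> pattern (edge_class c) x0 p S l) -> has_extremal_structure c.
Proof.
move=> nm ul sl pat.
(* The number [n.*2] serves as an even [p] that no index reaches. *)
have pn : n <= n.*2 by lia.
apply: (@extremal_from_pattern n C c x0 l n.*2 (fun _ _ => true)
  (\bigcup_(1 <= k < m.+1) [set [set order_of x0 l (2 * k - 1); order_of x0 l (2 * k)]])) => //.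
- by rewrite odd_double.
- apply/subsetP => e; rewrite mem_bigcup_seq => /hasP[k].
  rewrite mem_index_iota inE => km /eqP->; rewrite pairs2 /order_of nth_uniq ?sl //; lia.
- move=> i j ij; rewrite mem_bigcup_seq /joined /lead.
  have -> : i < n.*2 by lia.
  have -> : j < n.*2 by lia.
  rewrite leqNgt (_ : i < n.*2) /= ?andbT; last by lia.
  apply/hasP/eqP => [[k]|E].
    rewrite mem_index_iota inE /order_of => km.
    rewrite eq_set2_nth ?sl //; lia.
  exists (i./2.+1); first by rewrite mem_index_iota; lia.
  rewrite inE /order_of eq_set2_nth ?sl //; lia.
- by apply: pat; rewrite sl.
- exact: ExtremalOdd.
Qed.

Lemma card_selected (T : finType) (e1 e2 e3 : T) (b1 b2 b3 : bool) : 0 < b1 + b2 + b3 < 3 ->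
  1 <= #|[set e | [|| b1 && (e == e1), b2 && (e == e2) | b3 && (e == e3)]]| <= 2.
Proof.
move=> bb; set A := [set e | _].
have [f fA] : exists f, f \in A.
  rewrite /A; case: b1 b2 b3 bb {A} => [] [] [] // _; first
    [by exists e1; rewrite inE eqxx | by exists e2; rewrite inE eqxx ?orbT
    | by exists e3; rewrite inE eqxx ?orbT].
have -> : 0 < #|A| by apply/card_gt0P; exists f.
have [g [h sA]] : exists g h, A \subset [set g; h].
  rewrite /A; case: b1 b2 b3 bb {A fA} => [] [] [] // _; first
    [exists e1, e2; by apply/subsetP => e; rewrite !inE ?orbF
    | exists e1, e3; by apply/subsetP => e; rewrite !inE ?orbF
    | exists e2, e3; by apply/subsetP => e; rewrite !inE ?orbF
    | exists e1, e2; by apply/subsetP => e; rewrite !inE ?orbF /= => ->; rewrite ?orbT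
    | exists e1, e3; by apply/subsetP => e; rewrite !inE ?orbF /= => ->; rewrite ?orbT].
by apply: leq_trans (subset_leq_card sA) _; rewrite cards2; case: (_ != _).
Qed.

(** The three alternatives match the three parts of $J$ in [ExtremalEven]: pairs before the triple
    start at even positions, those after it at odd ones. *)
Lemma joined_cases p (b1 b2 b3 : bool) i j : i < j -> ~~ odd p ->
  joined p (sel b1 b2 b3) i j =
  [|| [&& ~~ odd i, j == i.+1 & i < p],
      [|| b1 && ((i == p) && (j == p.+1)), b2 && ((i == p) && (j == p.+2))
        | b3 && ((i == p.+1) && (j == p.+2))]
    | [&& odd i, j == i.+1 & p.+3 <= i]].
Proof.
move=> ij op; rewrite /joined.
case: (ltnP i p) => ip.
  rewrite /lead ip /= andbT; case: (ltnP j p) => jp; first by lia.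
  by case: (ltnP j p.+3) => jp3; lia.
have nip : (i < p) = false by rewrite ltnNge ip.
have njp : (j < p) = false by rewrite ltnNge (leq_trans ip (ltnW ij)).
case: (ltnP i p.+3) => ip3 /=; last first.
  have nip3 : (i < p.+3) = false by rewrite ltnNge ip3.
  have njp3 : (j < p.+3) = false by rewrite ltnNge (leq_trans ip3 (ltnW ij)).
  rewrite /lead nip njp nip3 njp3; lia.
case: (ltnP j p.+3) => jp3; last first.
  have njp3 : (j < p.+3) = false by rewrite ltnNge jp3.
  rewrite /lead nip njp ip3 njp3; lia.
rewrite /lead nip njp ip3 jp3 eqxx /= !andbF orbF.
have p2 : p.+2 - p = 2 by clear; lia.
have [E|[E|E]] : (i = p /\ j = p.+1) \/ (i = p /\ j = p.+2) \/ (i = p.+1 /\ j = p.+2) by lia.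
- by case: E => -> ->; rewrite /sel subnn subSnn /=; clear; case: b1 b2 b3 => [] [] []; lia.
- by case: E => -> ->; rewrite /sel subnn p2 /=; clear; case: b1 b2 b3 => [] [] []; lia.
- by case: E => -> ->; rewrite /sel subSnn p2 /=; clear; case: b1 b2 b3 => [] [] []; lia.
Qed.

Lemma even_extremal n m (C : eqType) (c : {set complete_graph n} -> C) (x0 : 'I_n) (l : seq 'I_n) p
    (b1 b2 b3 : bool) :
  n = 2 * m -> uniq l -> size l = n -> ~~ odd p -> p + 3 <= size l -> 0 < b1 + b2 + b3 < 3 ->
  pattern (edge_class c) x0 p (sel b1 b2 b3) l -> has_extremal_structure c.
Proof.
move=> nm ul sl op ps bb pat; rewrite sl in ps.
(* With this [a] the vertex $v_{2a-1}$ is at position [p], where the triple starts. *)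
pose a := p./2.+1; have ap : p = 2 * a - 2 by rewrite /a; clear -op; lia.
pose v := order_of x0 l.
have vE k : v k = nth x0 l k.-1 by [].
pose e1 := [set v (2 * a - 1); v (2 * a)]; pose e2 := [set v (2 * a - 1); v (2 * a + 1)].
pose e3 := [set v (2 * a); v (2 * a + 1)].
pose T := [set e | [|| b1 && (e == e1), b2 && (e == e2) | b3 && (e == e3)]].
have v1 : v (2 * a - 1) = nth x0 l p by rewrite vE; congr nth; clear -ap; lia.
have v2 : v (2 * a) = nth x0 l p.+1 by rewrite vE; congr nth; clear -ap; lia.
have v3 : v (2 * a + 1) = nth x0 l p.+2 by rewrite vE; congr nth; clear -ap; lia.
have TE e : (e \in T) = [|| b1 && (e == e1), b2 && (e == e2) | b3 && (e == e3)] by rewrite inE.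
have cT : 1 <= #|T| <= 2 by exact: card_selected.
have neq i j : i < n -> j < n -> i != j -> nth x0 l i != nth x0 l j.
  by move=> jn jn' ij; rewrite nth_uniq ?sl.
have [p0 p1 p2] : [/\ p < n, p.+1 < n & p.+2 < n] by clear -ps; split; lia.
pose J := (\bigcup_(1 <= k < a) [set [set v (2 * k - 1); v (2 * k)]]) :|: T
       :|: (\bigcup_(a.+1 <= k < m) [set [set v (2 * k); v (2 * k + 1)]]).
apply: (@extremal_from_pattern n C c x0 l p (sel b1 b2 b3) J) => //.
- apply/subsetP => e; rewrite !in_setU !mem_bigcup_seq -orbA => /or3P[/hasP[k]||/hasP[k]].
  + rewrite mem_index_iota inE => km /eqP->; rewrite pairs2 !vE.
    by apply: neq; clear -nm ps ap km; lia.
  + rewrite TE => /or3P[]/andP[_ /eqP->]; rewrite /e1 /e2 /e3 ?v1 ?v2 ?v3 pairs2;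
    by apply: neq => //; clear; lia.
  + rewrite mem_index_iota inE => km /eqP->; rewrite pairs2 !vE.
    by apply: neq; clear -nm ps ap km; lia.
- move=> i j ij; rewrite !in_setU !mem_bigcup_seq TE /e1 /e2 /e3 v1 v2 v3.
  have pp : p < p.+2 by clear; lia.
  rewrite !eq_set2_nth ?sl ?p0 ?p1 ?p2 ?ltnSn ?pp //.
  rewrite joined_cases //; last by case/andP: ij.
  rewrite -orbA; congr orb; last congr orb.
  + apply/hasP/idP => [[k]|E].
      rewrite mem_index_iota inE !vE => km; have k2 : 2 * k - 2 < 2 * k - 1 < n.
        by clear -km nm ps ap; lia.
      rewrite (_ : (2 * k - 1).-1 = 2 * k - 2); last by clear; lia.
      rewrite -subn1 eq_set2_nth ?sl //; clear -km ap; lia.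
    exists (i./2.+1); first by rewrite mem_index_iota; clear -E ap; lia.
    rewrite inE !vE eq_set2_nth ?sl //; first by clear -E; lia.
    by clear -E ij; lia.
  + apply/hasP/idP => [[k]|E].
      rewrite mem_index_iota inE !vE => km; have k2 : 2 * k - 1 < 2 * k < n.
        by clear -km nm; lia.
      rewrite -subn1 addn1 /= eq_set2_nth ?sl //; clear -km ap; lia.
    exists (i./2.+1); first by rewrite mem_index_iota; clear -E ap nm ij; lia.
    rewrite inE !vE eq_set2_nth ?sl //; first by clear -E; lia.
    by clear -E ij; lia.
- apply: (@ExtremalEven n v m a T) => //.
  + by clear -ps nm; lia.
  + by clear -ps ap nm; lia.
  + apply/subsetP => e; rewrite TE inE => /or3P[]/andP[_ /eqP->];
    rewrite /e1 /e2 /e3; apply/andP; split; first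
    [ by apply/subsetP => x; rewrite !inE => /orP[]->; rewrite ?orbT
    | by rewrite cards2 ?v1 ?v2 ?v3 neq //; clear; lia ].
Qed.

(** * The lower bound *)

Lemma is_starI (T : finType) (F : {set {set T}}) x :
  F \subset pairs [set: T] -> F != set0 -> (forall e : {set T}, e \in F -> x \in e) -> is_star F.
Proof.
move=> sF F0 xF; pose L := [set y | (y != x) && ([set x; y] \in F)].
have EF : F = [set [set x; y] | y in L].
  apply/setP => e; apply/idP/imsetP => [eF|[y]]; last by rewrite inE => /andP[_ yF] ->.
  have /pairsP[a [b [ab E]]] := subsetP sF e eF; have := xF e eF; rewrite E !inE => /orP[]/eqP xE.
    by subst a; exists b; rewrite // inE -E eF eq_sym ab.
  by subst b; exists a; rewrite 1?setUC // inE setUC -E eF ab.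
exists x, L; split=> //; first by rewrite inE eqxx.
by apply: contraNneq F0 => L0; rewrite EF L0 imset0.
Qed.

Section LowerBound.

Variable n : nat.

Definition consecutive (e : {set 'I_n}) :=
  [exists x in e, exists y in e, ~~ odd x && (y == x.+1 :> nat)].

(** Even values are the old colours and odd values the new ones. A new colour is used on one edge
    only, from an even position to the next. *)
Definition low_colouring (x0 : 'I_n) (e : {set complete_graph n}) : nat :=
  (min_colouring (order_of x0 (enum 'I_n)) e).*2 + consecutive e.

Variable x0 : 'I_n.

Lemma low_colouringE (x y : 'I_n) : x < y ->
  low_colouring x0 [set x; y] = x.+1.*2 + (~~ odd x && (y == x.+1 :> nat)).
Proof.
move=> xy; rewrite /low_colouring.
have E : [set x; y] = [set nth x0 (enum 'I_n) x; nth x0 (enum 'I_n) y] by rewrite !nth_ord_enum.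
rewrite [in X in X.*2]E min_order ?enum_uniq ?size_enum_ord ?xy ?ltn_ord //; congr (_ + nat_of_bool _).
apply/exists_inP/idP => [[a]|h]; last first.
  by exists x; rewrite ?inE ?eqxx //; apply/exists_inP; exists y; rewrite ?inE ?eqxx ?orbT.
rewrite !inE => ax /exists_inP[b]; rewrite !inE => bx.
by case/orP: ax => /eqP->; case/orP: bx => /eqP->; lia.
Qed.

Lemma low_star : star_colouring (G := complete_graph n) (low_colouring x0).
Proof.
move=> k; rewrite mem_undup => /imageP[e /pairsP[x [y [xy E]]] Ek]; subst e.
wlog ltxy : x y xy Ek / x < y.
  move=> W; case: (ltngtP x y) => [||/val_inj e]; [exact: W | | by rewrite e eqxx in xy].
  by move=> h; apply: (W y x) => //; rewrite 1?eq_sym // Ek setUC.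
(* Halving a colour recovers the smaller end of the edge, so this end is a common centre. *)
apply: (is_starI (x := x)).
- by apply/subsetP => e; rewrite inE => /andP[].
- by apply/set0Pn; exists [set x; y]; rewrite inE pairs2 xy Ek eqxx.
move=> e; rewrite inE => /andP[/pairsP[a [b [ab ->]]] /eqP].
wlog ltab : a b ab / a < b.
  move=> W; case: (ltngtP a b) => [||/val_inj e0]; [exact: W | | by rewrite e0 eqxx in ab].
  by move=> h; rewrite setUC; apply: W; rewrite // eq_sym.
rewrite Ek !low_colouringE // => h.
have -> : x = a by apply: val_inj => /=; lia.
by rewrite !inE eqxx.
Qed.

Definition low_nat (i j : nat) : nat :=
  (minn i j).+1.*2 + (~~ odd (minn i j) && (maxn i j == (minn i j).+1)).

Lemma low_natE (x y : 'I_n) : x != y -> low_colouring x0 [set x; y] = low_nat x y.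
Proof.
move=> xy; rewrite /low_nat; case: (ltngtP x y) => [h|h|/val_inj e]; last by rewrite e eqxx in xy.
  by rewrite low_colouringE.
by rewrite setUC low_colouringE.
Qed.

Lemma low_natC i j : low_nat i j = low_nat j i.
Proof. by rewrite /low_nat minnC maxnC. Qed.

Lemma low_nat_lt i j : i < j -> low_nat i j = i.+1.*2 + (~~ odd i && (j == i.+1)).
Proof. by move=> ij; rewrite /low_nat (minn_idPl (ltnW ij)) (maxn_idPr (ltnW ij)). Qed.

(** At its smallest vertex $a$ a copy has at most two colours, the second only on the edge to $a+1$
    with $a$ even; so $a$ does not have degree three. If it has degree two, $a+1$ is a neighbour of
    degree three and is odd, so its two edges to larger vertices agree. *)
Lemma low_nat_rainbow x y z w : uniq [:: x; y; z; w] ->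
  ~~ uniq [:: low_nat x y; low_nat x z; low_nat y z; low_nat y w; low_nat z w].
Proof.
have key i j k : i < j -> i < k -> low_nat i j != low_nat i k ->
    ~~ odd i && ((j == i.+1) || (k == i.+1)).
  by move=> ij ik; rewrite !low_nat_lt //; lia.
have corner a b e f : a < b -> a < e -> a < f -> b != e -> b != f -> e != f ->
    low_nat a b != low_nat a e -> low_nat b e != low_nat b f ->
    low_nat e b != low_nat e f -> False.
  move=> ab ae af be bf ef /key => /(_ ab ae) /andP[oa /orP[]/eqP E] h1 h2.
    have [? ?] : b < e /\ b < f by lia.
    by have := key b e f; rewrite h1; lia.
  have [? ?] : e < b /\ e < f by lia.
  by have := key e b f; rewrite h2; lia.
have hub a b e f : a < b -> a < e -> a < f -> b != e -> b != f -> e != f ->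
    low_nat a b != low_nat a e -> low_nat a b != low_nat a f ->
    low_nat a e != low_nat a f -> False.
  by move=> ab ae af be bf ef /key => /(_ ab ae) h1 /key => /(_ ab af) h2 /key => /(_ ae af); lia.
rewrite /= !inE !negb_or /= !andbT -!andbA => /and5P[xy xz xw yz /andP[yw zw]].
have m : [|| [&& x < y, x < z & x < w], [&& y < x, y < z & y < w],
    [&& z < x, z < y & z < w] | [&& w < x, w < y & w < z]] by lia.
apply/negP => /and5P[n1 n2 n3 n4 /and5P[n5 n6 n7 n8 /andP[n9 n10]]].
case/or4P: m => /and3P[h1 h2 h3].
- by apply: (corner x y z w); rewrite // (low_natC z y).
- by apply: (hub y x z w); rewrite ?(low_natC y x).
- by apply: (hub z x y w); rewrite ?(low_natC z x) ?(low_natC z y).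
- by apply: (corner w y z x); 
    rewrite ?(low_natC w y) ?(low_natC w z) ?(low_natC z x) ?(low_natC z y) ?(low_natC y x) // eq_sym.
Qed.

Lemma low_no_rainbow : ~ has_rainbow_copy K4minus (G := complete_graph n) (low_colouring x0).
Proof.
case=> f [finj fE cinj].
pose o k : 'I_4 := inord k.
have oE i j : i < 4 -> j < 4 -> (o i == o j) = (i == j).
  by move=> i4 j4; rewrite -val_eqE /= !inordK.
have fo i j : i < 4 -> j < 4 -> i != j -> f (o i) != f (o j).
  by move=> i4 j4 ij; rewrite (inj_eq finj) oE.
have u4 : uniq [:: val (f (o 0)); val (f (o 1)); val (f (o 2)); val (f (o 3))].
  by rewrite /= !inE !negb_or !val_eqE !fo.
have c2 i j : i < 4 -> j < 4 -> i != j ->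
    low_nat (f (o i)) (f (o j)) = low_colouring x0 (f @: [set o i; o j]).
  by move=> i4 j4 ij; rewrite imsetU1 imset_set1 low_natE ?fo.
have o0 : ord0 = o 0 by apply: val_inj; rewrite /= inordK.
have o3 : ord_max = o 3 by apply: val_inj; rewrite /= inordK.
have ed i j : i < j < 4 -> (i, j) != (0, 3) -> [set o i; o j] \in edges K4minus.
  move=> ij n03; have [i4 j4] : i < 4 /\ j < 4 by lia.
  rewrite in_setD1 pairs2 oE // o0 o3 neq_ltn (andP ij).1 andbT.
  apply/eqP => /setP E; have := E (o i); have := E (o j).
  rewrite !inE !oE // !eqxx; move: n03; rewrite xpair_eqE; lia.
have dist i j k l : i < j < 4 -> (i, j) != (0, 3) -> k < l < 4 -> (k, l) != (0, 3) ->
    (i, j) != (k, l) -> low_nat (f (o i)) (f (o j)) != low_nat (f (o k)) (f (o l)).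
  move=> ij nn ij' nn' N; rewrite !c2; try lia.
  apply/eqP => /cinj E; have {}E := E (ed i j ij nn) (ed k l ij' nn').
  move/setP: E => E; have Ei := E (o i); have Ej := E (o j).
  move: N; rewrite !inE !oE ?eqxx /= in Ei Ej; try lia.
  by rewrite xpair_eqE; lia.
by case/negP: (low_nat_rainbow u4); rewrite /= !inE !negb_or !dist.
Qed.

Lemma low_size : (3 * (n - 1)) %/ 2 <= size (colours (G := complete_graph n) (low_colouring x0)).
Proof.
(* Each $q$ contributes three colours: $k=3q,3q+1,3q+2$ stand for the edges from $2q$ to $2q+1$,
   from $2q$ to $2q+2$ and from $2q+1$ to $2q+2$. *)
pose a k := 2 * (k %/ 3) + (k %% 3 == 2); pose b k := 2 * (k %/ 3) + 1 + (k %% 3 != 0).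
pose h k := low_nat (a k) (b k).
have ab k : a k < b k by rewrite /a /b; lia.
have hE k : h k = 4 * (k %/ 3) + 2 + nth 0 [:: 1; 0; 2] (k %% 3).
  rewrite /h low_nat_lt // /a /b; have := ltn_pmod k (isT : 0 < 3).
  case: (k %% 3) => [|[|[|r]]] //= _; lia.
have u : uniq [seq h k | k <- iota 0 ((3 * (n - 1)) %/ 2)].
  rewrite map_inj_uniq ?iota_uniq // => k k'; rewrite !hE.
  move: (divn_eq k 3) (divn_eq k' 3) (ltn_pmod k (isT : 0 < 3)) (ltn_pmod k' (isT : 0 < 3)).
  by case: (k %% 3) => [|[|[|r]]] //; case: (k' %% 3) => [|[|[|r']]] //=; lia.
have := size_map h (iota 0 ((3 * (n - 1)) %/ 2)); rewrite size_iota => <-.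
apply: uniq_leq_size => // y /mapP[k]; rewrite mem_iota /= => kn ->.
have bn : b k < n by rewrite /b; lia.
have an : a k < n by apply: ltn_trans (ab k) bn.
have xy : Ordinal an != Ordinal bn by rewrite -val_eqE /= neq_ltn ab.
have -> : h k = low_colouring x0 [set Ordinal an; Ordinal bn] by rewrite low_natE.
by apply: mem_colours; rewrite pairs2.
Qed.

End LowerBound.

Theorem theorem1p6 (n : nat) (hn : 2 <= n) :
  is_ar_star n K4minus ((3 * (n - 1)) %/ 2) /\
  (forall (C : eqType) (c : {set complete_graph n} -> C),
     star_colouring c ->
     ~ has_rainbow_copy K4minus c ->
     size (colours c) = (3 * (n - 1)) %/ 2 ->
     has_extremal_structure c).
Proof.
have x0 : 'I_n := Ordinal (ltnW hn).
have bound (C : eqType) (c : {set complete_graph n} -> C) : star_colouring c ->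
    ~ has_rainbow_copy K4minus c -> size (colours c) <= (3 * (n - 1)) %/ 2.
  move=> st nr; rewrite size_colours; apply: leq_trans (cols_bound _ _ _) _.
  - exact: star_local.
  - exact: no_rainbow_local.
  - by rewrite cardsT card_ord.
split; [split=> [|t [c [st <- nr]]]; last exact: bound | move=> C c st nr sz].
  exists (low_colouring x0); have st := @low_star n x0; have nr := @low_no_rainbow n x0.
  by split=> //; apply/eqP; rewrite eqn_leq low_size bound.
have ls := star_local st; have ln := no_rainbow_local nr.
have sT : #|[set: 'I_n]| = n by rewrite cardsT card_ord.
have size_l (l : seq 'I_n) : uniq l -> l =i [set: 'I_n] -> size l = n.
  by move=> ul El; rewrite -(card_uniqP ul) (eq_card El).
rewrite size_colours in sz.
have {}sz : #|cols (edge_class c) [set: 'I_n]| = (3 * (#|[set: 'I_n]| - 1)) %/ 2 by rewrite sT.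
case: (boolP (odd n)) => on.
  have on' : odd #|[set: 'I_n]| by rewrite sT.
  have [U1|fU] := cols_max_odd ls ln on' sz; first by have n1 := etrans (esym sT) U1; clear -n1 hn; lia.
  have U0 : [set: 'I_n] != set0 by apply/set0Pn; exists x0; rewrite inE.
  have [l [ul El pat]] := full_pattern ls ln (or_intror (conj fU U0)).
  apply: (@odd_extremal n n./2 C c x0 l _ ul (size_l l ul El)); last exact: pat.
  by clear -on; lia.
case: (ltngtP n 2) => n2; [lia | | ].
  have on' : ~~ odd #|[set: 'I_n]| by rewrite sT.
  have n2' : 2 < #|[set: 'I_n]| by rewrite sT.
  have [u [uU fU oU]] := cols_max_even ls ln on' n2' sz.
  have [l [p [b1 [b2 [b3 [ul El [op ps] bb pat]]]]]] := even_pattern ls ln uU fU oU.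
  apply: (@even_extremal n n./2 C c x0 l p b1 b2 b3 _ ul (size_l l ul El)) => //.
  by clear -on; lia.
(* For [n = 2] the only edge is the whole vertex set, so any two colourings agree up to renaming. *)
exists (order_of x0 (enum 'I_n)), set0; split.
- by apply: order_of_ordering; rewrite ?enum_uniq ?size_enum_ord.
- exact: ExtremalTwo.
- apply: same_up_to_renaming_kernel => e e'.
  have T e0 : e0 \in pairs [set: 'I_n] -> e0 = setT.
    by rewrite inE => /andP[_ /eqP c2]; apply/eqP; rewrite eqEcard subsetT c2 sT n2.
  by move=> /T-> /T->; rewrite !eqxx.
Qed.
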